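(* Let $H$ be a Banach space and let $\rho:\mathfrak{vect}\to\mathcal{B}(H)$ be a representation of the Lie algebra $\mathfrak{vect}$ by bounded operators. Then $\rho$ can be canonically integrated to a uniformly continuous representation of the group $\mathbf{Diff}^\circ$ in $H$. Explicitly: for each $\gamma\in\mathbf{Diff}^\circ$, writing $\widehat\gamma=\sum_{n\ge0}u^{(n)}(\gamma)\in\overline{\mathbf{U}}(\mathfrak{vect})$ for the corresponding element of the completed enveloping algebra, the series $R(\gamma):=\sum_{n\ge0}\rho(u^{(n)}(\gamma))$ converges in the operator norm, and $R$ is a homomorphism from $\mathbf{Diff}^\circ$ to the group of invertible bounded operators in $H$ that is continuous with respect to the operator norm.
   Context: $\mathfrak{vect}$ is the real Lie algebra with basis $L_1,L_2,\dots$ and $[L_n,L_m]=(m-n)L_{m+n}$; it is realized on $\overline V=\mathbb{R}[[x]]$ by $L_n=x^{n+1}\frac{d}{dx}$. Its universal enveloping algebra $U(\mathfrak{vect})=\bigoplus_{n\ge0}U^{(n)}(\mathfrak{vect})$ is graded by $\deg L_n=n$; $\overline{\mathbf{U}}(\mathfrak{vect})$ is the algebra of formal series $\sum_{n\ge0}u^{(n)}$, $u^{(n)}\in U^{(n)}(\mathfrak{vect})$. A representation $\rho$ of $\mathfrak{vect}$ extends to a unital algebra homomorphism $\rho:U(\mathfrak{vect})\to\mathcal{B}(H)$, where $\mathcal{B}(H)$ is the algebra of bounded operators. $\overline{\mathbf{vect}}$ is the Lie algebra of formal series $\mathcal{L}=\sum_{j\ge1}b_jL_j$, $b_j\in\mathbb{R}$.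 $\overline{\mathbf{Diff}}$ is the set of formal power series $\gamma(x)=x+\sum_{j\ge2}a_jx^j$, $a_j\in\mathbb{R}$. For $\gamma\in\overline{\mathbf{Diff}}$ let $T(\gamma)F(x)=F(\gamma(x))$ on $\overline V$. Each $\gamma\in\overline{\mathbf{Diff}}$ determines a unique $\mathcal{L}\in\overline{\mathbf{vect}}$ such that $T(\gamma)=\sum_{k\ge0}\mathcal{L}^k/k!$ as operators on $\overline V$ (a known fact); set $\widehat\gamma:=\sum_{k\ge0}\mathcal{L}^k/k!\in\overline{\mathbf{U}}(\mathfrak{vect})$. The product in $\overline{\mathbf{Diff}}$ is taken with the order convention for which $T$ is a homomorphism, i.e. $T(\gamma_1\cdot\gamma_2)=T(\gamma_1)T(\gamma_2)$; explicitly $(\gamma_1\cdot\gamma_2)(x)=\gamma_2(\gamma_1(x))$. $\mathbf{Diff}^\circ$ is the subgroup of all $\gamma=x+\sum_{j\ge2}a_jx^j\in\overline{\mathbf{Diff}}$ with $\|a\|_\sigma:=\sum_{j\ge2}\frac{|a_j|\sigma^{j-1}}{j!}<\infty$ for all $\sigma>0$, with the topology defined by the family of norms $\|\cdot\|_\sigma$, $\sigma>0$, on the coefficient sequences. *)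

(* Defs.v *)
From HB Require Import structures.
From mathcomp Require Import all_boot all_order all_algebra.
From mathcomp Require Import finmap.
From mathcomp Require Import all_classical all_reals all_analysis.
(* The notations of [monalg] are incompatible with those of MathComp-Analysis:
   a noncommutative monomial is a [fmonom I] (a word in [seq I]), an element of
   the free algebra over [R] on [I] is a [malg (fmonom I) R], and
   [mkmalgU k c] is [c] times the basis element indexed by [k]. *)
From mathcomp.multinomials Require Import -(notations) monalg.

Set Implicit Arguments.
Unset Strict Implicit.
Unset Printing Implicit Defensive.

Import Order.TTheory GRing.Theory Num.Theory.
Import numFieldNormedType.Exports.

Local Open Scope classical_set_scope.
Local Open Scope ring_scope.

Section BoundedOperators.
Context {R : realType} {H : normedModType R}.

Definition bounded_linear_subdef (f : H -> H) : Prop :=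
  linear f /\ exists M : R, forall x, `|f x| <= M * `|x|.

Definition bounded_linear : {pred H -> H} :=
  fun f => `[< bounded_linear_subdef f >].

Lemma bounded_linear_submod_closed : submod_closed bounded_linear.
Proof.
split.
  apply/asboolP; split=> [a x y|]; first by rewrite /= scaler0 addr0.
  by exists 0 => x; rewrite mul0r normr0.
move=> a f g /asboolP [lf [M hM]] /asboolP [lg [N hN]]; apply/asboolP; split.
  move=> b x y; rewrite !fctE lf lg !scalerDr !scalerA (mulrC a b).
  by rewrite addrACA.
exists (`|a| * M + N) => x; rewrite fctE mulrDl.
apply: le_trans (ler_normD _ _) _; apply: lerD => //.
by rewrite normrZ -mulrA ler_wpM2l.
Qed.

HB.instance Definition _ :=
  GRing.isSubmodClosed.Build R (H -> H) bounded_linear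
    bounded_linear_submod_closed.

End BoundedOperators.

Record bounded_op (R : realType) (H : normedModType R) := BoundedOp {
  bounded_op_fun :> H -> H;
  bounded_op_funP : bounded_op_fun \in bounded_linear }.

Section BoundedOperatorsTheory.
Context {R : realType} {H : normedModType R}.
Local Notation B := (bounded_op H).
Implicit Types f g h : B.

HB.instance Definition _ := [isSub for @bounded_op_fun R H].
HB.instance Definition _ := [Choice of B by <:].
HB.instance Definition _ := [SubChoice_isSubLmodule of B by <:].

Lemma bounded_opP f g : (forall x, f x = g x) -> f = g.
Proof. by move=> fg; apply/val_inj/funext. Qed.

Lemma bounded_op_linear f : linear f.
Proof. by have /asboolP[] := bounded_op_funP f. Qed.

HB.instance Definition _ f :=
  GRing.isLinear.Build R H H _ (f : H -> H) (bounded_op_linear f).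

Lemma bounded_op_bounded f : exists M : R, forall x, `|f x| <= M * `|x|.
Proof. by have /asboolP[] := bounded_op_funP f. Qed.

Lemma bopDE f g x : (f + g) x = f x + g x. Proof. by []. Qed.
Lemma bopZE (a : R) f x : (a *: f) x = a *: f x. Proof. by []. Qed.
Lemma bop0E x : (0 : B) x = 0. Proof. by []. Qed.

Lemma bop_id_subproof : idfun \in bounded_linear (H := H).
Proof. by apply/asboolP; split=> //; exists 1 => x; rewrite mul1r. Qed.

Lemma bop_comp_subproof f g : (f \o g : H -> H) \in bounded_linear.
Proof.
apply/asboolP; split=> [a x y|]; first by rewrite /= !linearP.
have [M hM] := bounded_op_bounded f; have [N hN] := bounded_op_bounded g.
exists (`|M| * N) => x /=; apply: le_trans (hM _) _.
apply: le_trans (ler_wpM2r (normr_ge0 _) (ler_norm M)) _.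
by rewrite -mulrA ler_wpM2l.
Qed.

Definition bop_id : B := BoundedOp bop_id_subproof.
Definition bop_comp f g : B := BoundedOp (bop_comp_subproof f g).

Lemma bop_compA : associative bop_comp.
Proof. by move=> f g h; apply: bounded_opP. Qed.
Lemma bop_comp1o : left_id bop_id bop_comp.
Proof. by move=> f; apply: bounded_opP. Qed.
Lemma bop_compo1 : right_id bop_id bop_comp.
Proof. by move=> f; apply: bounded_opP. Qed.
Lemma bop_compDl : left_distributive bop_comp +%R.
Proof. by move=> f g h; apply: bounded_opP. Qed.
Lemma bop_compDr : right_distributive bop_comp +%R.
Proof. by move=> f g h; apply: bounded_opP => x; apply: (linearD f). Qed.

(* Not an [nzRingType], since [H] may be the null space. *)
HB.instance Definition _ := GRing.Zmodule_isPzRing.Build B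
  bop_compA bop_comp1o bop_compo1 bop_compDl bop_compDr.

Lemma bopME f g x : (f * g) x = f (g x). Proof. by []. Qed.
Lemma bop1E x : (1 : B) x = x. Proof. by []. Qed.

Lemma bop_scalerAl (a : R) f g : a *: (f * g) = (a *: f) * g.
Proof. by apply: bounded_opP. Qed.
Lemma bop_scalerAr (a : R) f g : a *: (f * g) = f * (a *: g).
Proof. by apply: bounded_opP => x; rewrite bopME !bopZE bopME linearZ. Qed.

Definition opnorm f : R := sup [set `|f x| | x in [set x : H | `|x| <= 1]].

Lemma opnorm_has_sup f :
  has_sup [set `|f x| | x in [set x : H | `|x| <= 1]].
Proof.
split; first by exists `|f 0|, 0 => //=; rewrite normr0.
have [M hM] := bounded_op_bounded f; exists `|M| => _ [x /= x1 <-].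
apply: le_trans (hM x) _; apply: le_trans (ler_norm _) _.
by rewrite normrM normr_id ler_piMr.
Qed.

Lemma opnorm_ge f x : `|x| <= 1 -> `|f x| <= opnorm f.
Proof.
by move=> x1; apply: (sup_upper_bound (opnorm_has_sup f)); exists x.
Qed.

Lemma opnorm_le f M : (forall x, `|x| <= 1 -> `|f x| <= M) -> opnorm f <= M.
Proof.
move=> hM; apply: ge_sup; first by case: (opnorm_has_sup f).
by move=> _ [x /= x1 <-]; apply: hM.
Qed.

Lemma opnorm_ge0 f : 0 <= opnorm f.
Proof.
by apply: le_trans (opnorm_ge f (x := 0) _); rewrite ?normr0.
Qed.

Lemma opnormP f x : `|f x| <= opnorm f * `|x|.
Proof.
have [->|x0] := eqVneq x 0; first by rewrite linear0 !normr0 mulr0.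
have nx0 : 0 < `|x| by rewrite normr_gt0.
rewrite -ler_pdivrMr// mulrC -[leLHS]ger0_norm ?mulr_ge0 ?invr_ge0//.
rewrite normrM normr_id -normrZ -linearZ; apply: opnorm_ge.
by rewrite normrZ normfV normr_id mulVf ?gt_eqF.
Qed.

Lemma opnormD f g : opnorm (f + g) <= opnorm f + opnorm g.
Proof.
apply: opnorm_le => x x1; rewrite bopDE.
by apply: le_trans (ler_normD _ _) _; apply: lerD; apply: opnorm_ge.
Qed.

Lemma opnormZ_le (a : R) f : opnorm (a *: f) <= `|a| * opnorm f.
Proof.
by apply: opnorm_le => x x1; rewrite bopZE normrZ ler_wpM2l// opnorm_ge.
Qed.

Lemma opnormZ (a : R) f : opnorm (a *: f) = `|a| * opnorm f.
Proof.
apply/eqP; rewrite eq_le opnormZ_le /=.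
have [->|a0] := eqVneq a 0; first by rewrite normr0 mul0r opnorm_ge0.
have {1}-> : f = a^-1 *: (a *: f) by rewrite scalerA mulVf// scale1r.
by rewrite -ler_pdivlMl ?normr_gt0// -normfV opnormZ_le.
Qed.

Lemma opnorm_eq0 f : opnorm f = 0 -> f = 0.
Proof.
move=> f0; apply: bounded_opP => x; apply/eqP; rewrite -normr_le0.
by have := opnormP f x; rewrite f0 mul0r.
Qed.

HB.instance Definition _ := Lmodule_isNormed.Build R B
  opnormD opnormZ opnorm_eq0.

Lemma bop_normE f : `|f| = opnorm f. Proof. by []. Qed.

End BoundedOperatorsTheory.

Notation "''B' ( H )" := (bounded_op H)
  (at level 8, format "''B' ( H )") : type_scope.

(* Indices are shifted: [vectL i] is L_{i+1}, the vector field x^{i+2} d/dx. *)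
Definition vect (R : realType) : Type := malg nat R.
HB.instance Definition _ (R : realType) := GRing.Lmodule.on (vect R).

Definition vectL {R : realType} (i : nat) : vect R := mkmalgU i 1.

Definition vect_bracket {R : realType} (u v : vect R) : vect R :=
  \sum_(i <- msupp (u : malg nat R)) \sum_(j <- msupp (v : malg nat R))
    (mcoeff i u * mcoeff j v * (j%:R - i%:R)) *: vectL (i + j).+1.

Definition is_representation (R : realType) (H : normedModType R)
    (rho : {linear vect R -> 'B(H)}) : Prop :=
  forall u v : vect R, rho (vect_bracket u v) = rho u * rho v - rho v * rho u.

Definition free_vect (R : realType) : Type := malg (fmonom nat) R.
HB.instance Definition _ (R : realType) := GRing.Lalgebra.on (free_vect R).

Section FreeAlgebra.
Context {R : realType}.
Local Notation word := (fmonom nat).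
Local Notation free := (free_vect R).
Implicit Types (x y : free) (m : word).

Definition monomial m (c : R) : free := mkmalgU m c.

Lemma free_vect_ind (P : free -> Prop) : P 0 ->
  (forall c m, P (monomial m c)) -> (forall x y, P x -> P y -> P (x + y)) ->
  forall x, P x.
Proof. by move=> P0 PU PD x; rewrite (monalgE x); apply: big_ind. Qed.

Lemma monomialM (c d : R) m n :
  monomial m c * monomial n d = monomial (mmul m n) (c * d).
Proof. by rewrite /monomial malgM_def fgmulUU. Qed.

Lemma monomialZ (a c : R) m : a *: monomial m c = monomial m (a * c).
Proof.
by apply/malgP => k; rewrite mcoeffZ !mcoeffU mulrnAr.
Qed.

Lemma free_vect_scalerAr (a : R) x y : a *: (x * y) = x * (a *: y).
Proof.
elim/free_vect_ind: x => [|c m|x x' hx hx']; first by rewrite !mul0r scaler0.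
  elim/free_vect_ind: y => [|d n|y y' hy hy'].
  - by rewrite scaler0 !mulr0 scaler0.
  - rewrite monomialZ; set p := monomial m c.
    rewrite [p * monomial n d]monomialM [p * monomial n (a * d)]monomialM.
    by rewrite monomialZ mulrCA.
  - rewrite mulrDr scalerDr scalerDr mulrDr; exact: congr2.
rewrite mulrDl scalerDr mulrDl; exact: congr2.
Qed.

(* deg L_{i+1} = i + 1 *)
Definition weight m : nat := (\sum_(i <- (m : seq nat)) i.+1)%N.

Lemma weight1 : weight (mone : word) = 0%N.
Proof. by rewrite /weight fm1 big_nil. Qed.

Lemma weightM m n : weight (mmul m n) = (weight m + weight n)%N.
Proof. by rewrite /weight fmM big_cat. Qed.

End FreeAlgebra.

Section Enveloping.
Context {R : realType}.
Local Notation word := (fmonom nat).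
Local Notation free := (free_vect R).

Definition freeL (i : nat) : free := monomial (fmu i) 1.

(* L_{i+1} L_{j+1} - L_{j+1} L_{i+1} - [L_{i+1}, L_{j+1}] *)
Definition env_relation (i j : nat) : free :=
  freeL i * freeL j - freeL j * freeL i - (j%:R - i%:R) *: freeL (i + j).+1.

Definition two_sided_ideal (J : set free) : Prop :=
  [/\ J 0, forall x y, J x -> J y -> J (x + y)
    & forall a x b, J x -> J (a * x * b)].

Definition env_ideal : {pred free} := fun x =>
  `[< forall J : set free, two_sided_ideal J ->
        (forall i j, J (env_relation i j)) -> J x >].

Lemma env_ideal_zmod_closed : zmod_closed env_ideal.
Proof.
split=> [|x y /asboolP Ix /asboolP Iy].
  by apply/asboolP => J [].
apply/asboolP => J idJ rJ; have [_ JD JM] := idJ.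
apply: JD; first exact: Ix.
by have := JM (-1) y 1 (Iy J idJ rJ); rewrite mulN1r mulr1.
Qed.

HB.instance Definition _ := GRing.isZmodClosed.Build free env_ideal
  env_ideal_zmod_closed.

Lemma env_idealM (a x b : free) : x \in env_ideal -> a * x * b \in env_ideal.
Proof.
move=> /asboolP Ix; apply/asboolP => J idJ rJ; have [_ _ JM] := idJ.
by apply: JM; apply: Ix.
Qed.

Lemma env_ideal_relation i j : env_relation i j \in env_ideal.
Proof. exact/asboolP. Qed.

End Enveloping.

Definition env (R : realType) : Type := Quotient.quot (@env_ideal R).

Section EnvelopingAlgebra.
Context {R : realType}.
Local Notation free := (free_vect R).
Local Notation U := (env R).
Local Open Scope quotient_scope.

HB.instance Definition _ := GRing.Zmodule.on U.
HB.instance Definition _ := EqQuotient.on U.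

Definition env_pi (x : free) : U := \pi_U x.

Lemma env_pi_eq x y : (env_pi x = env_pi y) <-> (x - y \in @env_ideal R).
Proof. by rewrite Quotient.idealrBE; split=> [e|/eqP //]; apply/eqP. Qed.

Lemma env_piP (P : U -> Prop) : (forall x, P (env_pi x)) -> forall u, P u.
Proof. by move=> h u; rewrite -[u]reprK; apply: h. Qed.

Lemma env_piK (u : U) : env_pi (repr u) = u.
Proof. exact: reprK. Qed.

Lemma env_piB : {morph env_pi : x y / x - y}.
Proof. by move=> x y; rewrite /env_pi !piE. Qed.

HB.instance Definition _ := GRing.isZmodMorphism.Build free U env_pi env_piB.

Definition env_mul (u v : U) : U := env_pi (repr u * repr v).
Definition env_scale (a : R) (u : U) : U := env_pi (a *: repr u).

Lemma env_repr_sub x : repr (env_pi x) - x \in @env_ideal R.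
Proof. by apply/env_pi_eq; rewrite env_piK. Qed.

Lemma env_pi_mul x y : env_mul (env_pi x) (env_pi y) = env_pi (x * y).
Proof.
apply/env_pi_eq; set x' := repr _; set y' := repr _.
have -> : x' * y' - x * y = 1 * (x' - x) * y' + x * (y' - y) * 1.
  by rewrite mul1r mulr1 mulrBl mulrBr addrA subrK.
by apply: rpredD; apply/env_idealM/env_repr_sub.
Qed.

Lemma env_pi_scale a x : env_scale a (env_pi x) = env_pi (a *: x).
Proof.
apply/env_pi_eq; rewrite -scalerBr -mul_malgC -[_ * _]mulr1.
exact/env_idealM/env_repr_sub.
Qed.

Lemma env_mulA : associative env_mul.
Proof.
elim/env_piP=> x; elim/env_piP=> y; elim/env_piP=> z.
by rewrite !env_pi_mul mulrA.
Qed.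
Lemma env_mul1l : left_id (env_pi 1) env_mul.
Proof. by elim/env_piP=> x; rewrite env_pi_mul mul1r. Qed.
Lemma env_mul1r : right_id (env_pi 1) env_mul.
Proof. by elim/env_piP=> x; rewrite env_pi_mul mulr1. Qed.
Lemma env_mulDl : left_distributive env_mul +%R.
Proof.
elim/env_piP=> x; elim/env_piP=> y; elim/env_piP=> z.
by rewrite -raddfD !env_pi_mul mulrDl raddfD.
Qed.
Lemma env_mulDr : right_distributive env_mul +%R.
Proof.
elim/env_piP=> x; elim/env_piP=> y; elim/env_piP=> z.
by rewrite -raddfD !env_pi_mul mulrDr raddfD.
Qed.

Lemma env_oner_neq0 : env_pi 1 != 0.
Proof.
rewrite -(raddf0 env_pi); apply/eqP => /env_pi_eq /asboolP.
pose e (x : free) : R := mcoeff mone x.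
have eD x y : e (x + y) = e x + e y by exact: raddfD.
have eB x y : e (x - y) = e x - e y by exact: raddfB.
have eM x y : e (x * y) = e x * e y by exact: rmorphM.
have eZ a x : e (a *: x) = a * e x by exact: mcoeffZ.
have e1 : e 1 = 1 by exact: rmorph1.
have e0 : e 0 = 0 by exact: raddf0.
have eL k : e (freeL k) = 0 by rewrite /e /freeL /monomial mcoeffU fm1_eq1.
clearbody e => /(_ [set x | e x = 0]); rewrite subr0 /= e1 => h.
suff /eqP : 1 = 0 :> R by rewrite oner_eq0.
apply: h => [|i j].
  split=> [//|x y /= x0 y0|a x b /= x0]; first by rewrite eD x0 y0 addr0.
  by rewrite !eM x0 mulr0 mul0r.
have eR (x y z : free) a : e x = 0 -> e y = 0 -> e z = 0 ->
    e (x * y - y * x - a *: z) = 0.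
  move=> x0 y0 z0.
  have xy0 : e (x * y) = 0 by apply: etrans (eM x y) _; rewrite x0 mul0r.
  have yx0 : e (y * x) = 0 by apply: etrans (eM y x) _; rewrite y0 mul0r.
  have az0 : e (a *: z) = 0 by apply: etrans (eZ a z) _; rewrite z0 mulr0.
  apply: etrans (eB _ _) _; apply: etrans (congr2 (fun b c => b - c) _ az0) _.
    exact: etrans (eB _ _) (congr2 (fun b c => b - c) xy0 yx0).
  by rewrite !subr0.
exact: eR.
Qed.

HB.instance Definition _ := GRing.Zmodule_isNzRing.Build U
  env_mulA env_mul1l env_mul1r env_mulDl env_mulDr env_oner_neq0.

Lemma env_scaleA (a b : R) (u : U) :
  env_scale a (env_scale b u) = env_scale (a * b) u.
Proof. by elim/env_piP: u => x; rewrite !env_pi_scale scalerA. Qed.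
Lemma env_scale1 : left_id 1 env_scale.
Proof. by elim/env_piP => x; rewrite !env_pi_scale scale1r. Qed.
Lemma env_scaleDr : right_distributive env_scale +%R.
Proof.
move=> a; elim/env_piP=> x; elim/env_piP=> y.
by rewrite -raddfD !env_pi_scale scalerDr raddfD.
Qed.
Lemma env_scaleDl (u : U) : {morph env_scale^~ u : a b / a + b}.
Proof.
by elim/env_piP: u => x a b; rewrite !env_pi_scale scalerDl raddfD.
Qed.

HB.instance Definition _ := GRing.Zmodule_isLmodule.Build R U
  env_scaleA env_scale1 env_scaleDr env_scaleDl.

Lemma env_piM : {morph env_pi : x y / x * y}.
Proof. by move=> x y; rewrite -env_pi_mul. Qed.

HB.instance Definition _ := GRing.isMonoidMorphism.Build free U env_pi
  (conj (erefl _) env_piM).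

Lemma env_piZ (a : R) x : env_pi (a *: x) = a *: env_pi x.
Proof. by rewrite -env_pi_scale. Qed.

HB.instance Definition _ := GRing.isScalable.Build R free U _ env_pi env_piZ.

Lemma env_scalerAl (a : R) (u v : U) : a *: (u * v) = (a *: u) * v.
Proof.
elim/env_piP: u => x; elim/env_piP: v => y.
by rewrite -rmorphM -!linearZ /= -rmorphM /= scalerAl.
Qed.

HB.instance Definition _ := GRing.Lmodule_isLalgebra.Build R U env_scalerAl.

Lemma env_scalerAr (a : R) (u v : U) : a *: (u * v) = u * (a *: v).
Proof.
elim/env_piP: u => x; elim/env_piP: v => y.
by rewrite -rmorphM -!linearZ /= -rmorphM /= free_vect_scalerAr.
Qed.

HB.instance Definition _ := GRing.Lalgebra_isAlgebra.Build R U env_scalerAr.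

Definition envL (i : nat) : U := env_pi (freeL i).

Lemma envL_bracket i j :
  envL i * envL j - envL j * envL i = (j%:R - i%:R) *: envL (i + j).+1.
Proof.
rewrite /envL -!rmorphM -raddfB -linearZ /=.
exact/env_pi_eq/env_ideal_relation.
Qed.

Definition env_inj (u : vect R) : U :=
  \sum_(i <- msupp (u : malg nat R)) mcoeff i u *: envL i.

(* U^{(n)}: the span of the words in the L_i whose indices add up to n *)
Definition env_degree (n : nat) : set U :=
  [set env_pi x | x in [set x : free |
    forall m, m \in msupp x -> weight m = n]].

Lemma env_degree0 n : env_degree n 0.
Proof. by exists 0; rewrite ?raddf0 //= => m; rewrite msupp0 in_fset0. Qed.

Lemma env_degreeD n u v : env_degree n u -> env_degree n v ->
  env_degree n (u + v).
Proof.
move=> [x hx <-] [y hy <-]; exists (x + y); last by rewrite raddfD.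
move=> m /(fsubsetP (msuppD_le _ _)); rewrite in_fsetU => /orP[].
  exact: hx.
exact: hy.
Qed.

Lemma env_degreeZ n a u : env_degree n u -> env_degree n (a *: u).
Proof.
move=> [x hx <-]; exists (a *: x); last by rewrite linearZ.
by move=> m /(fsubsetP (msuppZ_le _ _)); apply: hx.
Qed.

Lemma env_degree1 : env_degree 0 1.
Proof.
exists 1; last by rewrite rmorph1.
move=> m /=; rewrite -mcoeff_neq0 mcoeff1.
by have [->|_] := eqVneq m mone; rewrite ?weight1 ?eqxx.
Qed.

Lemma env_degreeL i : env_degree i.+1 (envL i).
Proof.
exists (freeL i) => // m /=; rewrite msuppU1 in_fset1 => /eqP ->.
by rewrite /weight fmU big_seq1.
Qed.

Lemma env_degreeM m n u v : env_degree m u -> env_degree n v ->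
  env_degree (m + n) (u * v).
Proof.
move=> [x hx <-] [y hy <-]; exists (x * y); last by rewrite rmorphM.
by move=> _ /msuppM_le [p [q [/hx <- /hy <- ->]]]; rewrite weightM.
Qed.

Lemma env_degree_sum n (I : Type) (s : seq I) (P : pred I) (F : I -> U) :
  (forall i, P i -> env_degree n (F i)) ->
  env_degree n (\sum_(i <- s | P i) F i).
Proof.
move=> h; apply: big_ind => //; first exact: env_degree0.
by move=> u v; apply: env_degreeD.
Qed.

End EnvelopingAlgebra.

Section Extension.
Context {R : realType} {H : normedModType R}.
Local Notation free := (free_vect R).
Implicit Types (rho : {linear vect R -> 'B(H)}).

Definition free_ext rho (x : free) : 'B(H) :=
  \sum_(m <- msupp x) mcoeff m x *: \prod_(i <- (m : seq nat)) rho (vectL i).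

Definition env_ext rho (u : env R) : 'B(H) := free_ext rho (repr u).

Lemma free_extEw rho (d : {fset fmonom nat}) x : (msupp x `<=` d)%fset ->
  free_ext rho x =
    \sum_(m <- d) mcoeff m x *: \prod_(i <- (m : seq nat)) rho (vectL i).
Proof.
move=> le; rewrite /free_ext (big_fset_incl _ le)//= => m _ /mcoeff_outdom ->.
by rewrite scale0r.
Qed.

Lemma free_ext_linear rho : linear (free_ext rho).
Proof.
move=> a x y; pose d := (msupp x `|` msupp y `|` msupp (a *: x + y))%fset.
have sx : (msupp x `<=` d)%fset by rewrite /d -fsetUA fsubsetUl.
have sy : (msupp y `<=` d)%fset by rewrite /d -fsetUA fsetUCA fsubsetUl.
rewrite (free_extEw rho sx) (free_extEw rho sy) (@free_extEw rho d); last exact: fsubsetUr.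
rewrite scaler_sumr -big_split; apply: eq_bigr => m _ /=.
by rewrite mcoeffD mcoeffZ scalerDl scalerA.
Qed.

HB.instance Definition _ rho := GRing.isLinear.Build R free 'B(H) _
  (free_ext rho) (free_ext_linear rho).

Lemma free_extU rho c m : free_ext rho (monomial m c) =
  c *: \prod_(i <- (m : seq nat)) rho (vectL i).
Proof. by rewrite (free_extEw _ msuppU_le) big_seq_fset1 mcoeffUU. Qed.

Lemma free_extM rho : {morph free_ext rho : x y / x * y}.
Proof.
move=> x y; elim/(@free_vect_ind R): x => [|c m|x x' hx hx'].
- by rewrite mul0r linear0 mul0r.
- elim/(@free_vect_ind R): y => [|d n|y y' hy hy'].
  + by rewrite mulr0 linear0 mulr0.
  + rewrite monomialM !free_extU fmM big_cat /= -bop_scalerAl -bop_scalerAr.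
    by rewrite scalerA.
  + rewrite mulrDr linearD; apply: etrans (congr2 +%R hy hy') _.
    by rewrite -mulrDr -linearD.
- rewrite mulrDl linearD; apply: etrans (congr2 +%R hx hx') _.
  by rewrite -mulrDl -linearD.
Qed.

Lemma free_ext1 rho : free_ext rho 1 = 1.
Proof. by rewrite -[1]/(monomial mone 1) free_extU fm1 big_nil scale1r. Qed.

Lemma free_extL rho i : free_ext rho (freeL i) = rho (vectL i).
Proof. by rewrite free_extU fmU big_seq1 scale1r. Qed.

Lemma vect_bracketL i j :
  vect_bracket (vectL i) (vectL j) = (j%:R - i%:R) *: vectL (i + j).+1 :> vect R.
Proof.
rewrite /vect_bracket /vectL !msuppU oner_eq0 !big_seq_fset1.
by rewrite !mcoeffUU !mul1r.
Qed.

Lemma free_ext_ideal rho x : is_representation rho ->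
  x \in @env_ideal R -> free_ext rho x = 0.
Proof.
move=> rep /asboolP /(_ [set x | free_ext rho x = 0]); apply.
  split=> [|y z y0 z0|a y b y0]; first exact: linear0.
    exact: etrans (linearD _ _ _) (etrans (congr2 +%R y0 z0) (addr0 0)).
  apply: etrans (free_extM rho _ _) _.
  by rewrite (free_extM rho a y) (y0 : free_ext rho y = 0) mulr0 mul0r.
move=> i j.
have fR (y z t : free) a : free_ext rho (y * z - z * y - a *: t) =
    (free_ext rho y * free_ext rho z - free_ext rho z * free_ext rho y) -
      a *: free_ext rho t.
  apply: etrans (linearB _ _ _) _; apply: congr2; last first.
    by congr (- _); exact: linearZ.
  apply: etrans (linearB _ _ _) _.
  by apply: congr2; [|congr (- _)]; exact: free_extM.
apply: etrans (fR _ _ _ _) _.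
by rewrite !free_extL -rep vect_bracketL linearZ subrr.
Qed.

Lemma env_ext_pi rho x : is_representation rho ->
  env_ext rho (env_pi x) = free_ext rho x.
Proof.
move=> rep; apply/eqP; rewrite -subr_eq0 -linearB; apply/eqP.
exact/free_ext_ideal/env_repr_sub.
Qed.

(* The three next lemmas: when [rho] is a representation, [env_ext rho] is a
   unital algebra morphism extending it. *)
Lemma env_ext_linear rho : is_representation rho -> linear (env_ext rho).
Proof.
move=> rep a; elim/(@env_piP R)=> x; elim/(@env_piP R)=> y.
by rewrite -linearP !env_ext_pi// linearP.
Qed.

Lemma env_ext_monoid_morphism rho : is_representation rho ->
  monoid_morphism (env_ext rho).
Proof.
move=> rep; split; first by rewrite -(rmorph1 env_pi) env_ext_pi// free_ext1.
elim/(@env_piP R)=> x; elim/(@env_piP R)=> y.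
by rewrite -rmorphM !env_ext_pi// free_extM.
Qed.

Lemma env_ext_inj rho u : is_representation rho ->
  env_ext rho (env_inj u) = rho u.
Proof.
move=> rep; have -> : env_inj u = env_pi (\sum_(i <- msupp (u : malg nat R))
    mcoeff i u *: freeL i).
  by rewrite linear_sum; apply: eq_bigr => i _; rewrite linearZ.
rewrite env_ext_pi// linear_sum.
have uE : u = \sum_(i <- msupp (u : malg nat R)) mcoeff i u *: vectL i.
  rewrite [LHS](monalgE (u : malg nat R)); apply: eq_bigr => i _.
  by apply/malgP => k; rewrite mcoeffZ !mcoeffU mulr_natr.
rewrite [in RHS]uE linear_sum; apply: eq_bigr => i _.
by rewrite linearZ /= free_extL linearZ.
Qed.

End Extension.

(* A formal series u^{(0)} + u^{(1)} + ... with u^{(n)} in U^{(n)}. *)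
Record completed_env (R : realType) := CompletedEnv {
  cenv_comp :> nat -> env R;
  cenv_compP : forall n, env_degree n (cenv_comp n) }.

Section CompletedEnv.
Context {R : realType}.
Local Notation Ubar := (completed_env R).
Implicit Types u v : Ubar.

Lemma cenv_one_subproof n : env_degree n (if n == 0%N then 1 else 0 : env R).
Proof. by case: n => [|n]; [exact: env_degree1|exact: env_degree0]. Qed.

Definition cenv_one : Ubar := CompletedEnv cenv_one_subproof.

Lemma cenv_mul_subproof u v n :
  env_degree n (\sum_(i < n.+1) u i * v (n - i)%N).
Proof.
apply: env_degree_sum => i _; have := env_degreeM (cenv_compP u i)
  (cenv_compP v (n - i)%N).
by rewrite subnKC// -ltnS ltn_ord.
Qed.

Definition cenv_mul u v : Ubar := CompletedEnv (cenv_mul_subproof u v).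

Definition cenv_pow u k : Ubar := iter k (cenv_mul u) cenv_one.

Lemma cenv_pow_eq0 u k n : u 0%N = 0 -> (n < k)%N -> cenv_pow u k n = 0.
Proof.
move=> u0; elim: k n => [//|k IH] n nk; rewrite /= big1// => -[[|i] /= ni] _.
  by rewrite u0 mul0r.
rewrite -/(cenv_pow u k) IH ?mulr0// ltn_subLR// addSn ltnS.
by rewrite (@leq_trans k)// leq_addl.
Qed.

Lemma cenv_exp_subproof u n :
  env_degree n (\sum_(k < n.+1) (k`!%:R^-1 : R) *: cenv_pow u k n).
Proof. by apply: env_degree_sum => k _; apply/env_degreeZ/cenv_compP. Qed.

(* The series of the u^k / k!, for u without constant term: by [cenv_pow_eq0]
   the terms with n < k do not contribute in degree n. *)
Definition cenv_exp u : Ubar := CompletedEnv (cenv_exp_subproof u).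

Lemma cenv_vect_subproof (b : nat -> R) n :
  env_degree n (if n is i.+1 then b i *: envL i else 0).
Proof.
case: n => [|i]; first exact: env_degree0.
exact/env_degreeZ/env_degreeL.
Qed.

(* A formal vector field \sum_i b_{i+1} L_{i+1} is represented by the sequence
   of the [b i] = b_{i+1}. *)
Definition cenv_vect (b : nat -> R) : Ubar :=
  CompletedEnv (cenv_vect_subproof b).

End CompletedEnv.

Section FormalDiffeomorphisms.
Context {R : realType}.
Implicit Types (F g b : nat -> R).

(* F(g(x)), for g without constant term: the coefficient of x^n depends only on
   the truncations of F and g at degree n. *)
Definition fps_comp F g : nat -> R := fun n =>
  ((\poly_(k < n.+1) F k) \Po (\poly_(k < n.+1) g k))`_n.

Lemma fps_comp_coef0 F g : g 0%N = 0 -> fps_comp F g 0 = F 0%N.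
Proof.
move=> g0; rewrite /fps_comp; set q := \poly_(k < 1) g k.
have -> : q = 0.
  by apply/polyP => -[|i]; rewrite coef_poly coef0 //= g0.
by rewrite comp_polyCr coefC /= horner_coef0 coef_poly.
Qed.

Lemma fps_comp_coef1 F g : g 0%N = 0 -> fps_comp F g 1 = F 1%N * g 1%N.
Proof.
move=> g0; rewrite /fps_comp.
have e G : \poly_(k < 2) G k = (G 1%N)%:P * 'X + (G 0%N)%:P :> {poly R}.
  by apply/polyP => -[|[|i]]; rewrite coef_poly !coefE /= ?mulr0 ?add0r ?addr0 ?mulr1.
rewrite !e g0 addr0 comp_polyD comp_polyM !comp_polyC comp_polyX.
by rewrite coefD coefC addr0 coefCM coefCM coefX mulr1.
Qed.

(* x^{i+2} d/dx maps x^k to k x^{k+i+1}. *)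
Definition vect_act b F : nat -> R := fun n =>
  \sum_(i < n) b i * (n - i.+1)%:R * F (n - i.+1)%N.

Lemma iter_vect_act_eq0 b F k n : (n < k)%N -> iter k (vect_act b) F n = 0.
Proof.
elim: k n => [//|k IH] n nk; rewrite iterS /vect_act big1// => i _.
rewrite IH ?mulr0// ltn_subLR ?ltn_ord// addSn ltnS.
by rewrite (@leq_trans k)// leq_addl.
Qed.

(* By [iter_vect_act_eq0] the coefficient of x^n in \sum_k b^k F / k! is a
   finite sum. *)
Definition exp_act b F : nat -> R := fun n =>
  \sum_(k < n.+1) (k`!%:R)^-1 * iter k (vect_act b) F n.

End FormalDiffeomorphisms.

Record formal_diff (R : realType) := FormalDiff {
  fdiff_coef :> nat -> R;
  fdiff_coefP : fdiff_coef 0%N = 0 /\ fdiff_coef 1%N = 1 }.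

Section FormalDiff.
Context {R : realType}.
Implicit Types g : formal_diff R.

Definition diffT g (F : nat -> R) : nat -> R := fps_comp F g.

Lemma fdiff_mul_subproof g1 g2 :
  fps_comp g2 g1 0 = 0 /\ fps_comp g2 g1 1 = 1.
Proof.
have [[g10 g11] [g20 g21]] := (fdiff_coefP g1, fdiff_coefP g2).
by rewrite fps_comp_coef0 ?fps_comp_coef1// g20 g21 g11 mulr1.
Qed.

(* (g1 . g2)(x) = g2(g1(x)) *)
Definition fdiff_mul g1 g2 : formal_diff R :=
  FormalDiff (fdiff_mul_subproof g1 g2).

(* The unique b with T(g) = exp(\sum_i b_i L_{i+1}); the default value 0 of [xget]
   is never used, since such a b exists for every g. *)
Definition fdiff_log g : nat -> R :=
  xget (0 : nat -> R) [set b | forall F, diffT g F = exp_act b F].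

Definition fdiff_hat g : completed_env R := cenv_exp (cenv_vect (fdiff_log g)).

Definition coef_norm (sigma : R) (a : nat -> R) : \bar R :=
  (\sum_(2 <= j <oo) (`|a j| * sigma ^+ j.-1 / j`!%:R)%:E)%E.

End FormalDiff.

Record diffo (R : realType) := Diffo {
  diffo_fdiff :> formal_diff R;
  diffo_norm_fin : forall sigma : R, 0 < sigma ->
    (coef_norm sigma diffo_fdiff < +oo)%E }.

Section DiffoTopology.
Context {R : realType}.

Lemma fdiff_id_subproof : (1%N == 0%N)%:R = 0 :> R /\ (1%N == 1%N)%:R = 1 :> R.
Proof. by []. Qed.

Definition fdiff_id : formal_diff R :=
  FormalDiff (fdiff_coef := fun j => (j == 1%N)%:R) fdiff_id_subproof.

Lemma diffo_id_subproof (sigma : R) : 0 < sigma ->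
  (coef_norm sigma fdiff_id < +oo)%E.
Proof.
move=> _; rewrite /coef_norm eseries0 ?ltry// => -[|[|j]] //= _ _.
by rewrite normr0 !mul0r.
Qed.

Definition diffo_id : diffo R := Diffo diffo_id_subproof.

HB.instance Definition _ := gen_eqMixin (diffo R).
HB.instance Definition _ := gen_choiceMixin (diffo R).
HB.instance Definition _ := isPointed.Build (diffo R) diffo_id.

(* center c.1.1, sigma = c.1.2, radius c.2 *)
Definition diffo_ball (c : diffo R * R * R) : set (diffo R) :=
  [set g : diffo R | (coef_norm c.1.2 (fun j => g j - c.1.1 j)%R < c.2%:E)%E].

HB.instance Definition _ := isSubBaseTopological.Build (diffo R)
  [set c : diffo R * R * R | 0 < c.1.2 /\ 0 < c.2] diffo_ball.

End DiffoTopology.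

Section Integration.
Context {R : realType} {H : completeNormedModType R}.
Implicit Types (rho : {linear vect R -> 'B(H)}) (g : formal_diff R).

Definition integrated_term rho g (n : nat) : 'B(H) := env_ext rho (fdiff_hat g n).

Definition integrated rho g : 'B(H) := lim (series (integrated_term rho g) @ \oo).

Definition invertible_op (A : 'B(H)) : Prop :=
  exists B : 'B(H), A * B = 1 /\ B * A = 1.

End Integration.

(* Main.v *)
Require Import Defs.
From mathcomp Require Import all_boot all_order all_algebra.
From mathcomp Require Import all_classical all_reals all_analysis.
From mathcomp Require Import ring lra zify.
Import Order.TTheory GRing.Theory Num.Theory.
Import numFieldNormedType.Exports.
Local Open Scope classical_set_scope.
Local Open Scope ring_scope.

Set Implicit Arguments.
Unset Strict Implicit.

(** Adjoin to vect the degree operator L_0 = x d/dx.  If T(gamma) = e^b, then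
    e^b L_0 e^{-b} = e^{ad b} L_0 is a formal vector field u (x d/dx plus terms
    of higher degree), and since x is an eigenvector of L_0 on R[[x]], u gamma =
    gamma, that is, u = (gamma/gamma') d/dx.  In the enveloping algebra the same
    conjugation identity applied to 1, which L_0 kills, says that
    W = sum_n rho(u^{(n)}(gamma)) satisfies Euler's equation
      n W_n = - sum_{1 <= i <= n} u_i rho(L_i) W_{n-i},
    which determines W from W_0 = 1.  Hence no Campbell-Hausdorff formula and no
    Poincare-Birkhoff-Witt theorem are needed: both W(gamma_1 gamma_2) and
    W(gamma_1) W(gamma_2) solve the equation attached to gamma_1 gamma_2.
    Since (n - 1) L_{n+1} = [L_1, L_n], |rho(L_n)| <= K s^n / n!; and the
    coefficients of gamma/gamma' are O(n! / k^n) for every k when gamma is in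
    Diff^o, since binomials absorb the convolution of factorials.  So |W_n|
    decays geometrically, locally uniformly in gamma, and the same holds for
    the inverse series. *)

(** * Graded modules over the formal vector fields *)

Lemma sum_triangle (V : nmodType) (f : nat -> nat -> V) n :
  \sum_(k < n.+1) \sum_(i < k.+1) f i (k - i)%N =
  \sum_(i < n.+1) \sum_(j < (n - i).+1) f i j.
Proof.
elim: n => [|n IHn]; first by rewrite !big_ord1.
rewrite big_ord_recr /= {}IHn [RHS]big_ord_recr /= subnn big_ord1.
rewrite [X in _ + X]big_ord_recr /= subnn addrA; congr (_ + _).
rewrite -big_split /=; apply: eq_bigr => i _.
have i_n : (i <= n)%N by rewrite -ltnS.
by rewrite subSn// [RHS]big_ord_recr.
Qed.

Lemma sum_triangleC (V : nmodType) (f : nat -> nat -> V) n :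
  \sum_(i < n.+1) \sum_(j < (n - i).+1) f i j =
  \sum_(i < n.+1) \sum_(j < (n - i).+1) f j i.
Proof.
rewrite -(sum_triangle f) -(sum_triangle (fun i j => f j i)).
apply: eq_bigr => k _; rewrite (reindex_inj rev_ord_inj) /=; apply: eq_bigr => i _.
by rewrite subSS subKn // -ltnS.
Qed.

Section GradedModule.
Context {R : realType} {V : lmodType R}.
Implicit Types (l : nat -> nat -> V -> V) (b v : nat -> R) (F G : nat -> V).

(* [l i m] is the action of L_i = x^{i+1} d/dx, for i >= 0, from degree m to
   degree m + i; in particular L_0 acts as the degree operator. *)
Record graded_module l : Prop := GradedModule {
  gmod_linear : forall i m, linear (l i m);
  gmod0 : forall m x, l 0%N m x = m%:R *: x;
  gmod_bracket : forall i j m x,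
    l i (m + j)%N (l j m x) - l j (m + i)%N (l i m x) =
    (j%:R - i%:R) *: l (i + j)%N m x }.

(** The formal vector field with coefficients [v] applied to a formal sum [F] of homogeneous
    components; each degree is a finite sum because L_i raises degrees by i. *)
Definition gact l v F : nat -> V := fun n =>
  \sum_(i < n.+1) v i *: l i (n - i)%N (F (n - i)%N).

(* By [iter_gact_eq0] the terms of the exponential series beyond the n-th do
   not contribute in degree n when [b 0 = 0]. *)
Definition gexp l b F : nat -> V := fun n =>
  \sum_(k < n.+1) k`!%:R^-1 *: iter k (gact l b) F n.

(* The adjoint action, with v_m the coefficient of L_m. *)
Definition ad_module (i m : nat) (a : R^o) : R^o := (m%:R - i%:R) * a.

End GradedModule.

Section GradedModuleTheory.
Context {R : realType} {V : lmodType R} {l : nat -> nat -> V -> V}.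
Context (lmod : graded_module l).
Implicit Types (b v : nat -> R) (F G : nat -> V).

Lemma gmod_eq0 i m : l i m 0 = 0.
Proof.
have := gmod_linear lmod i m (-1) 0 0.
by rewrite scaler0 addr0 scaleN1r addNr.
Qed.

Lemma gmodZ i m a x : l i m (a *: x) = a *: l i m x.
Proof.
by have := gmod_linear lmod i m a x 0; rewrite gmod_eq0 !addr0.
Qed.

Lemma gmod_sum i m (I : Type) (s : seq I) (P : pred I) (x : I -> V) :
  l i m (\sum_(k <- s | P k) x k) = \sum_(k <- s | P k) l i m (x k).
Proof.
apply: (big_morph (l i m) _ (gmod_eq0 i m)) => y z.
by have := gmod_linear lmod i m 1 y z; rewrite !scale1r.
Qed.

Lemma gact_sum v (I : Type) (s : seq I) (c : I -> R) (F : I -> nat -> V) n :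
  gact l v (fun m => \sum_(k <- s) c k *: F k m) n =
  \sum_(k <- s) c k *: gact l v (F k) n.
Proof.
under [RHS]eq_bigr => k _ do rewrite scaler_sumr.
rewrite exchange_big /=; apply: eq_bigr => i _.
rewrite gmod_sum scaler_sumr; apply: eq_bigr => k _.
by rewrite gmodZ !scalerA mulrC.
Qed.

Lemma gact_suml (I : Type) (s : seq I) (c : I -> R) (v : I -> nat -> R) F n :
  gact l (fun m => \sum_(k <- s) c k * v k m) F n =
  \sum_(k <- s) c k *: gact l (v k) F n.
Proof.
under [RHS]eq_bigr => k _ do rewrite scaler_sumr.
rewrite exchange_big /=; apply: eq_bigr => i _.
by rewrite scaler_suml; apply: eq_bigr => k _; rewrite scalerA.
Qed.

Lemma gact_eq v v' F G n :
  (forall i, (i <= n)%N -> v i = v' i) -> (forall i, (i <= n)%N -> F i = G i) ->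
  gact l v F n = gact l v' G n.
Proof.
by move=> vE FE; apply: eq_bigr => i _; rewrite vE -1?ltnS// FE ?leq_subr.
Qed.

Lemma gact_eq0 b F p n : b 0%N = 0 -> (forall m, (m < p)%N -> F m = 0) ->
  (n < p.+1)%N -> gact l b F n = 0.
Proof.
move=> b0 Fp np; apply: big1 => -[[|i] /= ni] _; first by rewrite b0 scale0r.
by rewrite Fp ?gmod_eq0 ?scaler0//; lia.
Qed.

(** Without an L_0 component, each application of [b] raises the lowest degree by at least one. *)
Lemma iter_gact_low b F p k n : b 0%N = 0 ->
  (forall m, (m < p)%N -> F m = 0) -> (n < p + k)%N ->
  iter k (gact l b) F n = 0.
Proof.
move=> b0 Fp; elim: k n => [|k IHk] n; first by rewrite addn0; apply: Fp.
by rewrite addnS iterS; apply: gact_eq0.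
Qed.

Lemma iter_gact_eq0 b F k n : b 0%N = 0 -> (n < k)%N ->
  iter k (gact l b) F n = 0.
Proof. by move=> b0; apply: (@iter_gact_low b F 0). Qed.

Lemma iter_gact_eq b F G k n : (forall m, (m <= n)%N -> F m = G m) ->
  iter k (gact l b) F n = iter k (gact l b) G n.
Proof.
elim: k n => [|k IHk] n FG; first exact: FG.
apply: gact_eq => // i i_n; apply: IHk => m mi.
by apply: FG; apply: leq_trans i_n.
Qed.

Lemma iter_gact_sum b (I : Type) (s : seq I) (c : I -> R) (F : I -> nat -> V) k n :
  iter k (gact l b) (fun m => \sum_(j <- s) c j *: F j m) n =
  \sum_(j <- s) c j *: iter k (gact l b) (F j) n.
Proof.
elim: k n => [//|k IHk] n; rewrite iterS -gact_sum.
by apply: gact_eq => // i _; rewrite IHk.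
Qed.

(** One truncation order serves all degrees below it, so that sums over degrees and over powers of
    [b] can be exchanged. *)
Lemma gexpE b F n K : b 0%N = 0 -> (n < K)%N ->
  gexp l b F n = \sum_(k < K) k`!%:R^-1 *: iter k (gact l b) F n.
Proof.
move=> b0 nK; rewrite /gexp (big_ord_widen K (fun k => k`!%:R^-1 *: iter k (gact l b) F n))//.
rewrite [RHS](bigID (fun k : 'I_K => (k < n.+1)%N)) /=.
rewrite [X in _ = _ + X]big1 ?addr0// => k; rewrite -leqNgt => nk.
by rewrite iter_gact_eq0// scaler0.
Qed.

Lemma gexp_low b F p n : b 0%N = 0 -> (forall m, (m < p)%N -> F m = 0) ->
  (n <= p)%N -> gexp l b F n = F n.
Proof.
move=> b0 Fp np; rewrite /gexp big_ord_recl /= fact0 invr1 scale1r.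
rewrite big1 ?addr0// => k _.
rewrite -iterS (iter_gact_low b0 Fp) ?scaler0//.
by rewrite addnS ltnS (leq_trans np) ?leq_addr.
Qed.

Lemma gexp_eq b F G n : (forall m, (m <= n)%N -> F m = G m) ->
  gexp l b F n = gexp l b G n.
Proof.
by move=> FG; apply: eq_bigr => k _; congr (_ *: _); apply: iter_gact_eq.
Qed.

Lemma gexp_sum b (I : Type) (s : seq I) (c : I -> R) (F : I -> nat -> V) n :
  gexp l b (fun m => \sum_(j <- s) c j *: F j m) n =
  \sum_(j <- s) c j *: gexp l b (F j) n.
Proof.
under [RHS]eq_bigr => j _ do rewrite scaler_sumr.
rewrite exchange_big /=; apply: eq_bigr => k _.
rewrite iter_gact_sum scaler_sumr; apply: eq_bigr => j _.
by rewrite !scalerA mulrC.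
Qed.

Lemma gactB v F G n :
  gact l v (fun m => F m - G m) n = gact l v F n - gact l v G n.
Proof.
rewrite -sumrB; apply: eq_bigr => i _; rewrite -scalerBr; congr (_ *: _).
have := gmod_linear lmod i (n - i)%N (-1) (G (n - i)%N) (F (n - i)%N).
by rewrite !scaleN1r ![- _ + _]addrC.
Qed.

Lemma gactS u F n : u 0%N = 1 -> gact l u F n =
  n%:R *: F n + \sum_(i < n) u i.+1 *: l i.+1 (n - i.+1)%N (F (n - i.+1)%N).
Proof.
move=> u0; rewrite /gact big_ord_recl subn0 /= u0 scale1r (gmod0 lmod).
by congr (_ + _).
Qed.

(** The uniqueness principle for Euler's equation: as L_0 multiplies degree n by n, the equation in
    degree n reads (n - k) F_n = terms of lower degree, so nothing appears beyond degree k. *)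
Lemma gact_eigen_eq0 u F k N : u 0%N = 1 ->
  (forall n, (n <= N)%N -> gact l u F n = k%:R *: F n) ->
  (forall n, (n <= k)%N -> F n = 0) -> forall n, (n <= N)%N -> F n = 0.
Proof.
move=> u0 uF Fk; elim/ltn_ind => n IHn nN.
have [/Fk //|kn] := leqP n k.
have := uF n nN; rewrite gactS// big1 ?addr0 => [/eqP|i _]; last first.
  by rewrite IHn ?gmod_eq0 ?scaler0//; have := ltn_ord i; lia.
rewrite -subr_eq0 -scalerBl scaler_eq0 -natrB ?(ltnW kn)// pnatr_eq0 subn_eq0.
by rewrite leqNgt kn /= => /eqP.
Qed.

(** The bracket axiom summed over pairs: commuting [b] past [v] leaves the field [b, v], which is
    what [ad_module] computes. *)
Lemma gact_bracket b v F n :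
  gact l b (gact l v F) n =
  gact l v (gact l b F) n + gact l (gact ad_module b v) F n.
Proof.
pose f i j := (b i * v j) *: l i (n - i)%N (l j (n - i - j)%N (F (n - i - j)%N)).
pose g i j := (b i * v j) *: l j (n - j)%N (l i (n - j - i)%N (F (n - j - i)%N)).
have -> : gact l b (gact l v F) n = \sum_(i < n.+1) \sum_(j < (n - i).+1) f i j.
  apply: eq_bigr => i _; rewrite /gact gmod_sum scaler_sumr.
  by apply: eq_bigr => j _; rewrite gmodZ scalerA.
have -> : gact l v (gact l b F) n = \sum_(i < n.+1) \sum_(j < (n - i).+1) g i j.
  rewrite sum_triangleC; apply: eq_bigr => j _; rewrite /gact gmod_sum scaler_sumr.
  by apply: eq_bigr => i _; rewrite gmodZ scalerA mulrC.
pose h i j := (b i * v j * (j%:R - i%:R)) *: l (i + j)%N (n - i - j)%N (F (n - i - j)%N).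
have -> : gact l (gact ad_module b v) F n = \sum_(i < n.+1) \sum_(j < (n - i).+1) h i j.
  rewrite -sum_triangle; apply: eq_bigr => k _.
  rewrite /gact scaler_suml; apply: eq_bigr => i _.
  have ik : (i <= k)%N by rewrite -ltnS.
  have nk : (n - i - (k - i) = n - k)%N by rewrite -subnDA subnKC.
  rewrite /h subnKC// nk /ad_module.
  by congr (_ *: _); rewrite /GRing.scale /=; ring.
rewrite -big_split; apply: eq_bigr => i _; rewrite -big_split; apply: eq_bigr => j _ /=.
rewrite /f /g /h.
have ij : (i + j <= n)%N.
  by have := ltn_ord i; have := ltn_ord j; rewrite !ltnS; lia.
move: ij; move: (nat_of_ord j) => {}j; move: (nat_of_ord i) => {}i ij.
have [-> ->] : (n - i = (n - i - j) + j)%N /\ (n - j = (n - i - j) + i)%N by lia.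
have -> : (n - i - j + j - j = n - i - j)%N by lia.
have -> : (n - i - j + i - i = n - i - j)%N by lia.
by rewrite -[X in _ + X]scalerA -(gmod_bracket lmod) -scalerDr addrCA subrr addr0.
Qed.

End GradedModuleTheory.

(** * Conjugation by the exponential of a formal vector field *)

Section Conjugation.
Context {R : realType} {V : lmodType R} {l : nat -> nat -> V -> V}.
Context (lmod : graded_module l).
Implicit Types (b v : nat -> R) (F : nat -> V).

Lemma ad_graded_module : graded_module (@ad_module R).
Proof.
split=> [i m a x y|m x|i j m x]; rewrite /ad_module /GRing.scale /= ?natrD; ring.
Qed.

(** The Leibniz rule for the divided powers b^k / k!, as [b] is a derivation of the pairing between
    vector fields and module elements. *)
Lemma iter_gact_gact b v F k n :
  k`!%:R^-1 *: iter k (gact l b) (gact l v F) n =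
  \sum_(j < k.+1) (j`!%:R^-1 * (k - j)`!%:R^-1) *:
    gact l (iter j (gact (@ad_module R) b) v) (iter (k - j) (gact l b) F) n.
Proof.
elim: k n => [|k IHk] n; first by rewrite big_ord1 /= fact0 invr1 mul1r.
pose X j i : V := gact l (iter j (gact (@ad_module R) b) v) (iter i (gact l b) F) n.
have fS m : (m.+1)`!%:R^-1 * m.+1%:R = m`!%:R^-1 :> R.
  by rewrite factS natrM invfM mulrAC mulVf ?mul1r// pnatr_eq0.
have k1 : k.+1%:R != 0 :> R by rewrite pnatr_eq0.
apply: (scalerI k1).
rewrite scalerA mulrC fS iterS.
transitivity (gact l b (fun m => k`!%:R^-1 *: iter k (gact l b) (gact l v F) m) n).
  (* Over a one-point list, [gact_sum] says that the scalar 1 / k! can be moved out. *)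
  have := @gact_sum _ _ _ lmod b _ [:: tt] (fun=> k`!%:R^-1)
    (fun=> iter k (gact l b) (gact l v F)) n.
  rewrite big_seq1 => <-; apply: gact_eq => // i _.
  by rewrite big_seq1.
transitivity (gact l b (fun m => \sum_(j < k.+1) (j`!%:R^-1 * (k - j)`!%:R^-1) *:
    gact l (iter j (gact (@ad_module R) b) v) (iter (k - j) (gact l b) F) m) n).
  by apply: gact_eq => // i _; rewrite IHk.
rewrite gact_sum//.
transitivity (\sum_(j < k.+1) (j`!%:R^-1 * (k - j)`!%:R^-1) *: X j (k.+1 - j)%N +
              \sum_(j < k.+1) (j`!%:R^-1 * (k - j)`!%:R^-1) *: X j.+1 (k - j)%N).
  rewrite -big_split; apply: eq_bigr => j _ /=; rewrite gact_bracket// scalerDr.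
  by rewrite /X subSn// -ltnS.
(* Both sums are put over the same range, the added end terms having weight zero; the weights j and
   k + 1 - j then add up to k + 1. *)
transitivity (\sum_(j < k.+2) (j%:R * j`!%:R^-1 * (k.+1 - j)`!%:R^-1) *: X j (k.+1 - j)%N +
   \sum_(j < k.+2) ((k.+1 - j)%:R * j`!%:R^-1 * (k.+1 - j)`!%:R^-1) *: X j (k.+1 - j)%N).
  rewrite addrC; congr (_ + _).
    rewrite [RHS]big_ord_recl /= !mul0r scale0r add0r; apply: eq_bigr => j _.
    by rewrite /= subSS [_.+1%:R * _]mulrC fS.
  rewrite [RHS]big_ord_recr /= subnn !mul0r scale0r addr0; apply: eq_bigr => j _.
  have jk : (j <= k)%N by rewrite -ltnS.
  by rewrite subSn// [_.+1%:R * _]mulrC -mulrA [_.+1%:R * _]mulrC fS.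
rewrite -big_split scaler_sumr; apply: eq_bigr => j _ /=.
rewrite -scalerDl scalerA -!mulrDl -natrD addnC subnK ?mulrA//.
by rewrite -ltnS.
Qed.

(* The exponential of the derivation [b] is multiplicative for the pairing
   [gact]. *)
Lemma gexp_gact b v F n : b 0%N = 0 ->
  gexp l b (gact l v F) n = gact l (gexp (@ad_module R) b v) (gexp l b F) n.
Proof.
move=> b0.
pose f j i : V := (j`!%:R^-1 * i`!%:R^-1) *:
  gact l (iter j (gact (@ad_module R) b) v) (iter i (gact l b) F) n.
transitivity (\sum_(j < n.+1) \sum_(i < (n - j).+1) f j i).
  rewrite -sum_triangle; apply: eq_bigr => k _.
  by rewrite iter_gact_gact; apply: eq_bigr.
(* The triangle extends to a square: for i + j > n the added terms vanish, since j applications of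
   [b] to [v] leave nothing below degree j, and i applications to [F] nothing below degree i. *)
transitivity (\sum_(j < n.+1) \sum_(i < n.+1) f j i).
  apply: eq_bigr => j _.
  have jn : ((n - j).+1 <= n.+1)%N by rewrite ltnS leq_subr.
  rewrite (big_ord_widen _ (f j) jn).
  rewrite [RHS](bigID (fun i : 'I_n.+1 => (i < (n - j).+1)%N)) /=.
  rewrite [X in _ = _ + X]big1 ?addr0// => i; rewrite -leqNgt => ji.
  rewrite /f; apply/eqP; rewrite scaler_eq0; apply/orP; right; apply/eqP.
  apply: big1 => m _; have [mj|jm] := ltnP m j.
    by rewrite (iter_gact_eq0 ad_graded_module)// scale0r.
  rewrite (iter_gact_eq0 lmod F b0) ?gmod_eq0 ?scaler0//.
  by have := ltn_ord m; lia.
transitivity (gact l (fun m => \sum_(j < n.+1) j`!%:R^-1 * iter j (gact (@ad_module R) b) v m)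
  (fun m => \sum_(i < n.+1) i`!%:R^-1 *: iter i (gact l b) F m) n).
  rewrite gact_suml//; apply: eq_bigr => j _; rewrite gact_sum// scaler_sumr.
  by apply: eq_bigr => i _; rewrite scalerA.
apply: gact_eq => i ni.
  by rewrite (@gexpE _ _ _ ad_graded_module b v i n.+1).
by rewrite (@gexpE _ _ _ lmod b F i n.+1).
Qed.

End Conjugation.

(** * Formal diffeomorphisms *)

Section FormalSeries.
Context {R : realType}.
Implicit Types (b u v g F : nat -> R).

(** This is R[[x]], with degree m spanned by x^m: x^{i+1} d/dx maps x^m to m x^{m+i}. *)
Definition poly_module (i m : nat) (a : R^o) : R^o := m%:R * a.

(* [b i] is the coefficient of L_{i+1}. *)
Definition vfield b : nat -> R := fun i => if i is j.+1 then b j else 0.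

Definition xpow (k : nat) : nat -> R^o := fun m => (m == k)%:R.

(* The vector field e^{ad b} (x d/dx), that is, g/g' d/dx if g = e^b x. *)
Definition symbol b : nat -> R :=
  gexp (@ad_module R) (vfield b) (fun i => (i == 0%N)%:R).

Lemma poly_graded_module : graded_module poly_module.
Proof.
split=> [i m a x y|m x|i j m x]; rewrite /poly_module /GRing.scale /= ?natrD; ring.
Qed.

Lemma exp_actE b F : exp_act b F = gexp poly_module (vfield b) F.
Proof.
have e G : vect_act b G = gact poly_module (vfield b) G.
  apply/funext => n; rewrite /gact big_ord_recl scale0r add0r.
  by apply: eq_bigr => i _; rewrite -mulrA.
by rewrite /exp_act (funext e).
Qed.

Lemma symbol0 b : symbol b 0%N = 1.
Proof. by rewrite /symbol (gexp_low (@ad_graded_module R) (p := 0)). Qed.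

(** The conjugation identity (e^b L_0 e^{-b}) e^b = e^b L_0, valid in every graded module. *)
Lemma gact_symbol (V : lmodType R) (l : nat -> nat -> V -> V) b (F : nat -> V) n :
  graded_module l ->
  gact l (symbol b) (gexp l (vfield b) F) n =
  gexp l (vfield b) (fun m => m%:R *: F m) n.
Proof.
move=> lmod; rewrite -(gexp_gact lmod)//; apply: gexp_eq => m _.
by rewrite gactS// big1 ?addr0// => i _; rewrite scale0r.
Qed.

(** Triangularity: as g = x + ..., the coefficient of x^{n+1} in u g is u_n plus a combination of
    the u_i with i < n. *)
Lemma gact_poly_inj u v g : g 0%N = 0 -> g 1%N = 1 ->
  gact poly_module u g =1 gact poly_module v g -> u =1 v.
Proof.
move=> g0 g1 uv; elim/ltn_ind => n IHn.
have := uv n.+1; rewrite /gact !big_ord_recr /= subnn g0 subSnn g1.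
rewrite /poly_module !mul0r !scaler0 !addr0 mul1r.
rewrite (eq_bigr (fun i : 'I_n => v i *: poly_module i (n.+1 - i) (g (n.+1 - i)%N))).
  by move/addrI; rewrite /GRing.scale /= !mulr1.
by move=> i _; rewrite IHn.
Qed.

Lemma symbol_rec u g n : g 0%N = 0 -> g 1%N = 1 ->
  gact poly_module u g =1 g ->
  u n = g n.+1 - \sum_(i < n) u i * ((n.+1 - i)%:R * g (n.+1 - i)%N).
Proof.
move=> g0 g1 /(_ n.+1) <-; rewrite /gact !big_ord_recr /= subnn subSnn g0 g1.
by rewrite /poly_module mul0r scaler0 addr0 mulr1 addrAC subrr add0r /GRing.scale /= mulr1.
Qed.

Section Composition.
Variables (b g : nat -> R).
Hypothesis gE : g = gexp poly_module (vfield b) (xpow 1).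

Let g0 : g 0%N = 0.
Proof. by rewrite gE (gexp_low poly_graded_module (p := 1))// => -[]. Qed.

Let g1 : g 1%N = 1.
Proof. by rewrite gE (gexp_low poly_graded_module (p := 1))// => -[]. Qed.

Let gexp_xpow_eigen k n :
  gact poly_module (symbol b) (gexp poly_module (vfield b) (xpow k)) n =
  k%:R *: gexp poly_module (vfield b) (xpow k) n.
Proof.
rewrite (gact_symbol _ _ _ poly_graded_module).
have := gexp_sum poly_graded_module (vfield b) [:: tt] (fun=> k%:R) (fun=> xpow k) n.
rewrite big_seq1 => <-; apply: gexp_eq => m _.
rewrite big_seq1 /xpow; have [->//|_] := eqVneq m k.
by rewrite !scaler0.
Qed.

Let gpoly N : {poly R} := \poly_(i < N.+1) g i.

Let gpoly_low N k : (k <= N)%N ->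
  (forall m, (m < k)%N -> (gpoly N ^+ k)`_m = 0) /\ (gpoly N ^+ k)`_k = 1.
Proof.
elim: k => [|k IHk] kN; first by rewrite expr0 coef1.
have [Hlow Hk] := IHk (ltnW kN).
rewrite exprS; split=> [m mk|]; rewrite coefM.
  apply: big1 => -[[|j] /= jm] _; rewrite coef_poly ?g0 ?mul0r//.
  by rewrite Hlow ?mulr0//; lia.
rewrite big_ord_recl big_ord_recl big1 => [|j _]; rewrite /= !coef_poly.
  by rewrite g0 mul0r add0r ltnS (leq_ltn_trans _ kN)// g1 mul1r addr0 subSS subn0.
by rewrite Hlow ?mulr0//; have := ltn_ord j; rewrite /bump; lia.
Qed.

(** The symbol acts as the derivation U x d/dx, so g being an eigenvector of value 1 makes g^k one
    of value k; cutting at degree N changes nothing up to degree N. *)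
Let gpoly_eigen N k n : (n <= N)%N ->
  gact poly_module (symbol b) (fun m => (gpoly N ^+ k)`_m) n =
  k%:R *: (gpoly N ^+ k)`_n.
Proof.
move=> nN.
pose U := \poly_(i < N.+1) symbol b i.
have dE (p : {poly R}) m : (m <= N)%N ->
    gact poly_module (symbol b) (fun m => p`_m) m = (U * ('X * p^`()))`_m.
  move=> mN; rewrite coefM; apply: eq_bigr => i _.
  rewrite coef_poly (leq_trans (ltn_ord i))// coefXM.
  case: (m - i)%N => [|j] /=; first by rewrite /poly_module mul0r.
  by rewrite coef_deriv /poly_module /GRing.scale /= mulr_natl.
rewrite dE//; case: k => [|k].
  by rewrite expr0 -polyC1 derivC !mulr0 coef0 scale0r.
rewrite deriv_exp /=.
have -> : U * ('X * ((gpoly N)^`() * gpoly N ^+ k *+ k.+1)) =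
    (gpoly N ^+ k *+ k.+1) * (U * ('X * (gpoly N)^`())).
  by rewrite !mulrnAr mulrnAl [_ ^+ k * _]mulrC !mulrA.
rewrite coefM; transitivity ((gpoly N ^+ k *+ k.+1 * gpoly N)`_n); last first.
  by rewrite mulrnAl -exprSr coefMn /GRing.scale /= mulr_natl.
rewrite coefM; apply: eq_bigr => i _; congr (_ * _).
have iN : (n - i <= N)%N by rewrite (leq_trans (leq_subr _ _)).
rewrite -dE// coef_poly ltnS iN.
have := gexp_xpow_eigen 1 (n - i); rewrite -gE scale1r => <-.
apply: gact_eq => // j jn; rewrite coef_poly ltnS (leq_trans jn)//.
Qed.

(** Multiplicativity of e^b on powers of x, obtained from uniqueness: e^b x^k and g^k are
    eigenvectors of the symbol of value k, and both agree with x^k up to degree k. *)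
Lemma gexp_xpow N k n : (k <= N)%N -> (n <= N)%N ->
  gexp poly_module (vfield b) (xpow k) n = (gpoly N ^+ k)`_n.
Proof.
move=> kN nN; apply/eqP; rewrite -subr_eq0; apply/eqP.
have [Hlow Hk] := gpoly_low kN.
apply: (gact_eigen_eq0 poly_graded_module
  (F := fun n => gexp poly_module (vfield b) (xpow k) n - (gpoly N ^+ k)`_n)
  (symbol0 b) (k := k) (N := N)) => // m mN.
  by rewrite (gactB poly_graded_module) gexp_xpow_eigen gpoly_eigen// scalerBr.
rewrite (gexp_low poly_graded_module (p := k))// => [|j jk]; last first.
  by rewrite /xpow ltn_eqF.
move: mN; rewrite leq_eqVlt => /predU1P[->|mk].
  by rewrite /xpow eqxx Hk subrr.
by rewrite /xpow ltn_eqF// Hlow// subrr.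
Qed.

Lemma fps_comp_gexp F : fps_comp F g = gexp poly_module (vfield b) F.
Proof.
apply/funext => n; rewrite /fps_comp [X in X \Po _]poly_def linear_sum coef_sum.
transitivity (\sum_(k < n.+1) F k *: gexp poly_module (vfield b) (xpow k) n).
  apply: eq_bigr => k _ /=; rewrite comp_polyZ comp_Xn_poly coefZ.
  by rewrite (@gexp_xpow n)// -ltnS.
rewrite -(gexp_sum poly_graded_module); apply: gexp_eq => m mn.
rewrite (bigD1 (Ordinal (mn : (m < n.+1)%N)))//= /xpow eqxx.
rewrite big1 ?addr0 => [|k kn]; first by rewrite /GRing.scale /= mulr1.
rewrite (_ : (m == k) = false) ?scaler0//.
by apply: contraNF kn => /eqP mk; apply/eqP/val_inj.
Qed.

End Composition.

(** A triangular system is solved by iteration: after n + 1 rounds the unknown of index n no longer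
    changes. *)
Lemma fixpoint_exists (T : Type) (Phi : (nat -> T) -> nat -> T) (t0 : T) :
  (forall n f h, (forall i, (i < n)%N -> f i = h i) -> Phi f n = Phi h n) ->
  exists f, forall n, f n = Phi f n.
Proof.
move=> Phi_loc; pose B k := iter k Phi (fun=> t0).
have BS k i : (i < k)%N -> B k i = B k.+1 i.
  elim: k i => [//|k IHk] i ik; apply: Phi_loc => j ji.
  exact/IHk/(leq_trans ji).
have Bn k i : (i < k)%N -> B k i = B i.+1 i.
  elim: k => [//|k IHk]; rewrite ltnS leq_eqVlt => /predU1P[->//|ik].
  by rewrite -BS// IHk.
exists (fun n => B n.+1 n) => n; apply: Phi_loc => i i_n.
exact: Bn.
Qed.

(** The coefficient of x^{m+2} in e^b x is [b m] plus a function of the earlier coefficients: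
    L_{m+1} sends x to x^{m+2}, and the terms of order at least two in [b] involve only lower
    L_i. *)
Lemma gexp_local b b' m : (forall i, (i < m)%N -> b i = b' i) ->
  gexp poly_module (vfield b) (xpow 1) m.+2 - b m =
  gexp poly_module (vfield b') (xpow 1) m.+2 - b' m.
Proof.
move=> bb'.
have sh i : (i <= m)%N -> vfield b i = vfield b' i.
  by case: i => [//|i] im; apply: bb'.
have loc k j : (j <= m.+1)%N -> iter k (gact poly_module (vfield b)) (xpow 1) j =
    iter k (gact poly_module (vfield b')) (xpow 1) j.
  elim: k j => [//|k IHk] j jm; rewrite !iterS; apply: eq_bigr => i _.
  have [->|ij] := eqVneq (i : nat) j.
    by rewrite subnn /poly_module !mul0r !scaler0.
  by have ? := ltn_ord i; rewrite sh ?IHk//; lia.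
have step c : gexp poly_module (vfield c) (xpow 1) m.+2 - c m =
    \sum_(k < m.+1) k.+2`!%:R^-1 *:
      iter k.+2 (gact poly_module (vfield c)) (xpow 1) m.+2.
  rewrite /gexp [X in X - _]big_ord_recl [X in _ + X - _]big_ord_recl /=.
  rewrite !invr1 !scale1r add0r.
  have -> : gact poly_module (vfield c) (xpow 1) m.+2 = c m.
    rewrite /gact 2!big_ord_recr /= subnn subSnn /poly_module mul0r scaler0 addr0.
    rewrite big1 ?add0r; first by rewrite /xpow /GRing.scale /= !mulr1.
    move=> i _; rewrite /xpow (_ : (_ == _) = false) ?mulr0 ?scaler0//.
    by have := ltn_ord i; lia.
  by rewrite addrAC subrr add0r.
rewrite !step; apply: eq_bigr => k _; congr (_ *: _).
rewrite !(iterS k.+1); apply: eq_bigr => i _.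
(* After at least one application nothing is left in degrees 0 and 1, so an outer L_i with i > m
   contributes nothing in degree m + 2. *)
have low c j : (j <= 1)%N -> iter k.+1 (gact poly_module (vfield c)) (xpow 1) j = 0.
  move=> j1; apply: (iter_gact_low poly_graded_module (p := 1)) => //; last by lia.
  by case.
have [im|mi] := leqP i m.
  case: (nat_of_ord i) im => [|i'] im; first by rewrite !scale0r.
  by rewrite sh// loc//; lia.
have mi1 : (m.+2 - i <= 1)%N by lia.
by rewrite !low// /poly_module !mulr0 !scaler0.
Qed.

Lemma gexp_surj g : g 0%N = 0 -> g 1%N = 1 ->
  exists b, g = gexp poly_module (vfield b) (xpow 1).
Proof.
move=> g0 g1.
have [b bE] := @fixpoint_exists R
  (fun b m => g m.+2 - (gexp poly_module (vfield b) (xpow 1) m.+2 - b m)) 0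
  (fun n f h fh => congr1 (fun x => g n.+2 - x) (gexp_local fh)).
exists b; apply/funext => -[|[|m]].
- by rewrite (gexp_low poly_graded_module (p := 1))// => -[].
- by rewrite (gexp_low poly_graded_module (p := 1))// => -[].
have := bE m; rewrite opprB addrCA -{1}[b m]addr0 => /addrI/esym/eqP.
by rewrite subr_eq0 => /eqP.
Qed.

Lemma fdiff_logP (g : formal_diff R) F :
  diffT g F = gexp poly_module (vfield (fdiff_log g)) F.
Proof.
have [g0 g1] := fdiff_coefP g; have [b gE] := gexp_surj g0 g1.
have : [set b | forall F, diffT g F = exp_act b F] (fdiff_log g).
  (* A logarithm exists by [gexp_surj], so [xget] does not return its default value. *)
  apply: (xgetPex (0 : nat -> R)); exists b => G.
  by rewrite exp_actE -(fps_comp_gexp gE).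
by move=> /= ->; rewrite exp_actE.
Qed.

Lemma diffT_x (g : formal_diff R) : diffT g (xpow 1) = g.
Proof.
have [g0 g1] := fdiff_coefP g; apply/funext => -[|n].
  by rewrite /diffT fps_comp_coef0// g0.
rewrite /diffT /fps_comp.
have -> : \poly_(k < n.+2) (xpow 1 k : R) = 'X :> {poly R}.
  by apply/polyP => -[|[|k]]; rewrite coef_poly coefX//= if_same.
by rewrite comp_polyX coef_poly leqnn.
Qed.

Lemma fdiff_logE (g : formal_diff R) :
  gexp poly_module (vfield (fdiff_log g)) (xpow 1) = g.
Proof. by rewrite -fdiff_logP diffT_x. Qed.

Lemma gact_symbol_fdiff (g : formal_diff R) :
  gact poly_module (symbol (fdiff_log g)) g =1 g.
Proof.
move=> n; rewrite -[in LHS](fdiff_logE g) (gact_symbol _ _ _ poly_graded_module).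
rewrite -[in RHS](fdiff_logE g); apply: gexp_eq => m _; rewrite /xpow.
by have [->|_] := eqVneq m 1%N; rewrite /GRing.scale /= ?mulr1 ?mulr0.
Qed.

(** Both vector fields fix the composite series: with u2 the symbol of g2, e^{b1} carries u2 g2 = g2
    to (e^{ad b1} u2)(g2 o g1) = g2 o g1. *)
Lemma symbol_fdiff_mul (g1 g2 : formal_diff R) :
  symbol (fdiff_log (fdiff_mul g1 g2)) =1
  gexp (@ad_module R) (vfield (fdiff_log g1)) (symbol (fdiff_log g2)).
Proof.
have [g0 g1'] := fdiff_coefP (fdiff_mul g1 g2).
apply: (gact_poly_inj g0 g1') => n; rewrite gact_symbol_fdiff /=.
rewrite -[fps_comp g2 g1]/(diffT g1 g2) fdiff_logP.
rewrite -(gexp_gact poly_graded_module)//; apply: gexp_eq => m _.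
by rewrite gact_symbol_fdiff.
Qed.

End FormalSeries.

(** * The graded action on bounded operators *)

Section CauchyProduct.
Context {A : pzRingType}.
Implicit Types (F G : nat -> A).

Definition cmul F G : nat -> A := fun n => \sum_(i < n.+1) F i * G (n - i)%N.

Definition cone : nat -> A := fun n => (n == 0%N)%:R.

Lemma cmulA F G K n : cmul F (cmul G K) n = cmul (cmul F G) K n.
Proof.
pose f i j := F i * (G j * K (n - i - j)%N).
transitivity (\sum_(i < n.+1) \sum_(j < (n - i).+1) f i j).
  by apply: eq_bigr => i _; rewrite mulr_sumr.
rewrite -sum_triangle; apply: eq_bigr => k _.
rewrite mulr_suml; apply: eq_bigr => i _.
have ik : (i <= k)%N by rewrite -ltnS.
by rewrite /f -subnDA subnKC// mulrA.
Qed.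

Lemma cmul1l F n : cmul cone F n = F n.
Proof.
rewrite /cmul big_ord_recl subn0 mul1r big1 ?addr0// => i _.
by rewrite mul0r.
Qed.

Lemma cmul1r F n : cmul F cone n = F n.
Proof.
rewrite /cmul big_ord_recr /= subnn mulr1 big1 ?add0r// => i _.
by rewrite /cone subn_eq0 leqNgt ltn_ord mulr0.
Qed.

Lemma cmul_eq F F' G G' n : (forall i, (i <= n)%N -> F i = F' i) ->
  (forall i, (i <= n)%N -> G i = G' i) -> cmul F G n = cmul F' G' n.
Proof.
move=> FF GG; apply: eq_bigr => i _.
by rewrite FF -1?ltnS// GG ?leq_subr.
Qed.

Lemma cmulIr F F' G : G 0%N = 1 -> cmul F G =1 cmul F' G -> F =1 F'.
Proof.
move=> G0 FF; elim/ltn_ind => n IHn; have := FF n.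
rewrite /cmul !big_ord_recr /= subnn G0 !mulr1.
rewrite (eq_bigr (fun i : 'I_n => F' i * G (n - i)%N)); first exact: addrI.
by move=> i _; rewrite IHn.
Qed.

End CauchyProduct.

Section OperatorSeries.
Context {R : realType} {H : completeNormedModType R}.
Variable rho : {linear vect R -> 'B(H)}.
Implicit Types (b u : nat -> R) (F G : nat -> 'B(H)).

(** The left regular action on formal series of operators; L_0, on which [rho] has no value, acts
    through the degree. *)
Definition op_module (i m : nat) (x : 'B(H)) : 'B(H) :=
  if i is j.+1 then rho (vectL j) * x else m%:R *: x.

Definition op_symbol u : nat -> 'B(H) :=
  fun i => if i is j.+1 then u i *: rho (vectL j) else 0.

Lemma gact_op_symbol u F n : u 0%N = 0 -> gact op_module u F n = cmul (op_symbol u) F n.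
Proof.
move=> u0; apply: eq_bigr => -[[|i] i_n] _ /=; first by rewrite u0 scale0r mul0r.
by rewrite bop_scalerAl.
Qed.

Hypothesis rho_rep : is_representation rho.

Lemma op_graded_module : graded_module op_module.
Proof.
split=> [[|i] m a x y /=|//|[|i] [|j] m x /=].
- by rewrite scalerDr !scalerA mulrC.
- by rewrite mulrDr bop_scalerAr.
- by rewrite !subrr scale0r.
- by rewrite -bop_scalerAr -scalerBl natrD subr0 addrAC subrr add0r.
- by rewrite -bop_scalerAr -scalerBl natrD sub0r opprD addrA subrr sub0r addn0.
- rewrite !mulrA -mulrBl -rho_rep vect_bracketL linearZ /= -bop_scalerAl.
  rewrite addnS; congr (_ *: _); rewrite -[j.+1%:R]natr1 -[i.+1%:R]natr1.
  by rewrite opprD addrACA subrr addr0.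
Qed.

(** Left multiplications commute with right multiplication by [G]; the field [vfield b] has no L_0
    component, whose action by the degree would not commute with it. *)
Lemma gexp_cmul b F G n :
  gexp op_module (vfield b) (cmul F G) n = cmul (gexp op_module (vfield b) F) G n.
Proof.
have it k m : iter k (gact op_module (vfield b)) (cmul F G) m =
    cmul (iter k (gact op_module (vfield b)) F) G m.
  elim: k m => [//|k IHk] m; rewrite !iterS gact_op_symbol//.
  rewrite (cmul_eq (F' := op_symbol (vfield b))
    (G' := cmul (iter k (gact op_module (vfield b)) F) G))// cmulA.
  by apply: cmul_eq => // i _; rewrite gact_op_symbol.
transitivity (cmul (fun m => \sum_(k < n.+1) k`!%:R^-1 *:
    iter k (gact op_module (vfield b)) F m) G n).
  rewrite /cmul; under [RHS]eq_bigr => i _ do rewrite mulr_suml.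
  rewrite exchange_big /=; apply: eq_bigr => k _.
  by rewrite it scaler_sumr; apply: eq_bigr => i _; rewrite bop_scalerAl.
by apply: cmul_eq => // i i_n; rewrite (@gexpE _ _ _ op_graded_module _ F i n.+1).
Qed.

Lemma env_ext0 : env_ext rho 0 = 0.
Proof.
have := env_ext_linear rho_rep (-1) 0 0.
by rewrite scaler0 addr0 scaleN1r addNr.
Qed.

Lemma env_extZ (a : R) x : env_ext rho (a *: x) = a *: env_ext rho x.
Proof. by have := env_ext_linear rho_rep a x 0; rewrite env_ext0 !addr0. Qed.

Lemma env_ext_sum (I : Type) (s : seq I) (c : I -> R) (x : I -> env R) :
  env_ext rho (\sum_(i <- s) c i *: x i) = \sum_(i <- s) c i *: env_ext rho (x i).
Proof.
elim: s => [|i s IHs]; first by rewrite !big_nil env_ext0.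
by rewrite !big_cons (env_ext_linear rho_rep) IHs.
Qed.

Lemma integrated_termE g n :
  integrated_term rho g n = gexp op_module (vfield (fdiff_log g)) cone n.
Proof.
have [e1 eM] := env_ext_monoid_morphism rho_rep.
rewrite /integrated_term /= env_ext_sum; apply: eq_bigr => k _; congr (_ *: _).
set b := fdiff_log g.
move: (nat_of_ord k) => {}k; elim: k n => [|j IHj] n.
  by case: n => // n; apply: env_ext0.
rewrite /= gact_op_symbol//.
transitivity (env_ext rho (\sum_(i < n.+1) 1 *:
    (cenv_vect b i * cenv_pow (cenv_vect b) j (n - i)%N))).
  by congr (env_ext rho _); apply: eq_bigr => i _; rewrite scale1r.
rewrite env_ext_sum; apply: eq_bigr => i _; rewrite scale1r eM IHj; congr (_ * _).
case: (nat_of_ord i) => [|i'] /=; first exact: env_ext0.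
by rewrite env_extZ /envL env_ext_pi// free_extL.
Qed.

Lemma symbol_integrated_term g n :
  gact op_module (symbol (fdiff_log g)) (integrated_term rho g) n = 0.
Proof.
rewrite (funext (integrated_termE g)) (gact_symbol _ _ _ op_graded_module).
rewrite (_ : (fun m => _) = (fun=> 0)).
  apply: big1 => k _; rewrite (iter_gact_low op_graded_module (p := n.+1)) ?scaler0//.
  by rewrite ltnS leq_addr.
by apply/funext => -[|m] /=; rewrite ?scale0r ?scaler0.
Qed.

Lemma integrated_term0 g : integrated_term rho g 0%N = 1.
Proof. by rewrite integrated_termE (gexp_low op_graded_module (p := 0)). Qed.

(** The right-hand side is e^{b1} W(g2), and the symbol of the product kills it: by
    [symbol_fdiff_mul] the result is e^{b1} (u2 W(g2)) = 0, with u2 the symbol of g2. Uniqueness for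
    the eigenvalue 0 concludes. *)
Lemma integrated_termM (g1 g2 : formal_diff R) n :
  integrated_term rho (fdiff_mul g1 g2) n =
  cmul (integrated_term rho g1) (integrated_term rho g2) n.
Proof.
set b1 := fdiff_log g1; set b2 := fdiff_log g2.
have -> : cmul (integrated_term rho g1) (integrated_term rho g2) n =
    gexp op_module (vfield b1) (integrated_term rho g2) n.
  transitivity (cmul (gexp op_module (vfield b1) cone) (integrated_term rho g2) n).
    by apply: cmul_eq => // i _; rewrite integrated_termE.
  by rewrite -gexp_cmul; apply: gexp_eq => m _; rewrite cmul1l.
apply/eqP; rewrite -subr_eq0; apply/eqP.
apply: (gact_eigen_eq0 op_graded_module (F := fun n =>
  integrated_term rho (fdiff_mul g1 g2) n -
  gexp op_module (vfield b1) (integrated_term rho g2) n)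
  (symbol0 (fdiff_log (fdiff_mul g1 g2))) (k := 0) (N := n)) => // m.
  move=> _; rewrite (gactB op_graded_module) symbol_integrated_term sub0r scale0r.
  rewrite (gact_eq (v' := gexp (@ad_module R) (vfield b1) (symbol b2))
    (G := gexp op_module (vfield b1) (integrated_term rho g2)))// => [|i _]; last first.
    exact: symbol_fdiff_mul.
  rewrite -(gexp_gact op_graded_module)//.
  rewrite (@gexp_eq _ _ _ _ _ (fun=> 0)) => [|i _]; last first.
    exact: symbol_integrated_term.
  by rewrite (gexp_low op_graded_module (p := m)) ?oppr0.
rewrite leqn0 => /eqP->; rewrite integrated_term0.
by rewrite (gexp_low op_graded_module (p := 0))// integrated_term0 subrr.
Qed.

Lemma integrated_term_rec g n :
  n%:R *: integrated_term rho g n =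
  - cmul (op_symbol (symbol (fdiff_log g))) (integrated_term rho g) n.
Proof.
apply/eqP; rewrite -addr_eq0 -[X in _ == X](symbol_integrated_term g n).
rewrite (gactS op_graded_module) ?symbol0// /cmul big_ord_recl mul0r add0r.
apply/eqP; congr (_ + _); apply: eq_bigr => i _.
by rewrite /op_symbol /= bop_scalerAl.
Qed.

(** With D the degree derivation, D W = - C W, and [V] is chosen to solve the mirror equation D V =
    V C; hence D (V W) = 0 and V W = 1. The equation of the same shape gives [V] the same growth
    bounds as W, with no estimate on the inverse diffeomorphism. *)
Lemma inverse_term_exists g : exists V : nat -> 'B(H),
  [/\ V 0%N = 1,
      forall n, n%:R *: V n = cmul V (op_symbol (symbol (fdiff_log g))) n,
      cmul V (integrated_term rho g) =1 cone
    & cmul (integrated_term rho g) V =1 cone].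
Proof.
set C := op_symbol _; set W := integrated_term rho g.
pose Phi (V : nat -> 'B(H)) n : 'B(H) :=
  if n == 0%N then 1 else n%:R^-1 *: \sum_(i < n) V i * C (n - i)%N.
have [|V VE] := @fixpoint_exists 'B(H) Phi 0.
  move=> n f h fh; rewrite /Phi; case: ifP => // _; congr (_ *: _).
  by apply: eq_bigr => i _; rewrite fh.
have V0 : V 0%N = 1 by rewrite VE.
have W0 : W 0%N = 1 by apply: integrated_term0.
have VC n : n%:R *: V n = cmul V C n.
  rewrite /cmul big_ord_recr /= subnn mulr0 addr0.
  case: n => [|n]; first by rewrite big_ord0 scale0r.
  by rewrite {1}VE /Phi /= scalerA divff ?scale1r// pnatr_eq0.
have VW n : cmul V W n = cone n.
  case: n => [|n]; first by rewrite /cmul big_ord1 V0 W0 mulr1.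
  have n1 : n.+1%:R != 0 :> R by rewrite pnatr_eq0.
  apply: (scalerI n1); rewrite scaler0.
  transitivity (cmul (fun m => m%:R *: V m) W n.+1 + cmul V (fun m => m%:R *: W m) n.+1).
    rewrite scaler_sumr -big_split; apply: eq_bigr => i _ /=.
    have i_n : (i <= n.+1)%N by rewrite -ltnS.
    rewrite -bop_scalerAl -bop_scalerAr -scalerDl -natrD subnKC//.
  have -> : cmul (fun m => m%:R *: V m) W n.+1 = cmul (cmul V C) W n.+1.
    by apply: cmul_eq => // i _; apply: VC.
  have -> : cmul V (fun m => m%:R *: W m) n.+1 = cmul V (fun m => - cmul C W m) n.+1.
    by apply: cmul_eq => // i _; apply: integrated_term_rec.
  rewrite -cmulA -big_split big1// => i _ /=.
  by rewrite mulrN subrr.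
exists V; split=> //.
(* (W V) W = W (V W) = W, and W, whose constant term is 1, can be cancelled on the right. *)
apply: (cmulIr W0) => n; rewrite -cmulA cmul1l (cmul_eq (F' := W) (G' := cone))//.
exact: cmul1r.
Qed.

End OperatorSeries.

(** * Growth of the coefficients *)

Section RealEstimates.
Context {R : realType}.
Implicit Types (F S : R) (x : nat -> R).

Definition rec_const F S : R := 2 * F * (1 + S) ^+ Num.bound (2 * S).

Lemma rec_const_ge0 F S : 0 <= F -> 0 <= S -> 0 <= rec_const F S.
Proof. by move=> F0 S0; rewrite !mulr_ge0// exprn_ge0// addr_ge0. Qed.

(* Below the index [2 S] each step multiplies the bound by at most [1 + S];
   beyond it, the bound is preserved. *)
Lemma rec_bound F S x : 0 <= F -> 0 <= S -> x 0%N <= F ->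
  (forall n M, (0 < n)%N -> 0 <= M -> (forall m, (m < n)%N -> x m <= M) ->
    n%:R * x n <= n%:R * F + S * M) ->
  forall n, x n <= rec_const F S.
Proof.
move=> F0 S0 x0 xrec; set p := Num.bound (2 * S).
have pS : 2 * S <= p%:R by apply/ltW/archi_boundP; rewrite mulr_ge0.
have S1 : 1 <= 1 + S by rewrite lerDl.
(* The factor 2 gives F <= B n / 2; once the index exceeds 2 S, the other half of the bound absorbs
   the term in S. *)
pose B n := 2 * F * (1 + S) ^+ minn n p.
have BF n : 2 * F <= B n by rewrite ler_peMr ?mulr_ge0// exprn_ege1.
have Bmono m n : (m <= n)%N -> B m <= B n.
  move=> mn; rewrite ler_wpM2l ?mulr_ge0// ler_weXn2l//; lia.
suff xB n : x n <= B n.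
  move=> n; apply: le_trans (xB n) _.
  by rewrite ler_wpM2l ?mulr_ge0// ler_weXn2l// geq_minr.
elim/ltn_ind: n => -[|n] IHn.
  by apply: le_trans (BF _); apply: le_trans x0 _; lra.
have B0 : 0 <= B n by apply: le_trans (BF n); rewrite mulr_ge0.
have /(xrec n.+1 (B n) isT B0) h : forall m, (m < n.+1)%N -> x m <= B n.
  by move=> m mn; apply: le_trans (IHn m mn) _; apply: Bmono.
have n0 : 0 < n.+1%:R :> R by rewrite ltr0n.
rewrite -(ler_pM2l n0); apply: le_trans h _.
have BFn := BF n.
have [np|pn] := ltnP n p.
  have -> : B n.+1 = (1 + S) * B n.
    by rewrite /B (minn_idPl np) (minn_idPl (ltnW np)) exprS mulrCA.
  have n1 : 1 <= n.+1%:R :> R by rewrite ler1n.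
  have : 0 <= (n.+1%:R - 1) * (S * B n) by apply: mulr_ge0; [rewrite subr_ge0|apply: mulr_ge0].
  have : 0 <= n.+1%:R * (B n - F) by rewrite mulr_ge0 ?(ltW n0)//; lra.
  lra.
have -> : B n.+1 = B n by rewrite /B !(minn_idPr _)// leqW.
have : p%:R <= n.+1%:R :> R by rewrite ler_nat leqW.
move=> /(le_trans pS) nS.
have : 0 <= (n.+1%:R - 2 * S) * B n by rewrite mulr_ge0// subr_ge0.
have : 0 <= n.+1%:R * (B n - 2 * F) by rewrite mulr_ge0 ?(ltW n0)// subr_ge0.
lra.
Qed.

Lemma sum_half n : \sum_(i < n) (2^-1 : R) ^+ i.+1 <= 1.
Proof.
suff -> : \sum_(i < n) (2^-1 : R) ^+ i.+1 = 1 - 2^-1 ^+ n.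
  by rewrite gerBl exprn_ge0.
elim: n => [|n IHn]; first by rewrite big_ord0 expr0 subrr.
by rewrite big_ord_recr /= IHn exprS; field.
Qed.

Lemma leq_bin n i : (0 < i < n)%N -> (n <= 'C(n, i))%N.
Proof.
elim: n i => [|n IHn] [|i] //=; rewrite ltnS => i_n; rewrite binS.
move: i_n; rewrite leq_eqVlt => /predU1P[<-|i_n].
  by rewrite binn binSn.
apply: (leq_trans (n := (n + 1)%N)); first by rewrite addn1.
by rewrite leq_add ?IHn// bin_gt0 ltnW// ltnW.
Qed.

(** This is n <= C(n, i); the gained factor n pays for convolving factorial weights. *)
Lemma fact_mul_le n i : (0 < i < n)%N ->
  n%:R * (i`!%:R * (n - i)`!%:R) <= n`!%:R :> R.
Proof.
move=> i_n; rewrite -!natrM ler_nat -(bin_fact (n := n) (m := i)) ?leq_mul ?leq_bin//.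
by case/andP: i_n => _ /ltnW.
Qed.

Lemma sqr_le_4exp m : m.+1%:R ^+ 2 <= 4 ^+ m :> R.
Proof.
have -> : 4 = 2%:R ^+ 2 :> R by rewrite expr2; ring.
rewrite -exprM mulnC exprM lerXn2r ?nnegrE ?exprn_ge0//.
by rewrite -natrX ler_nat ltn_expl.
Qed.

End RealEstimates.

Section SymbolEstimate.
Context {R : realType}.
Implicit Types (u g : nat -> R) (N k : R).

(** The size of the coefficient of x^{m+1} in x g', measured against m! / k^m. *)
Let e g k m : R := m.+1%:R * `|g m.+1| * k ^+ m / m`!%:R.

(** The two factors m + 1, one from the derivative and one from (m+1)! / m!, cost at most 4^m, and
    the spare 8^m leaves (1/2)^m. *)
Let e_le g k N m : 0 < k -> 0 <= N ->
  `|g m.+1| <= N * (m.+1)`!%:R / (8 * k) ^+ m ->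
  e g k m <= N * 2^-1 ^+ m.
Proof.
move=> k0 N0 gm.
have m0 : 0 < m`!%:R :> R by rewrite ltr0n fact_gt0.
have km : 0 < k ^+ m by rewrite exprn_gt0.
have m1 : 0 < m.+1%:R :> R by rewrite ltr0n.
rewrite /e ler_pdivrMr//.
apply: (le_trans (y := m.+1%:R * (N * (m.+1)`!%:R / (8 * k) ^+ m) * k ^+ m)).
  by rewrite ler_wpM2r ?(ltW km)// ler_wpM2l// ltW.
have -> : m.+1%:R * (N * (m.+1)`!%:R / (8 * k) ^+ m) * k ^+ m =
    N * m`!%:R * (m.+1%:R ^+ 2 / 8 ^+ m).
  rewrite factS natrM exprMn; field.
  by rewrite !expf_neq0 ?gt_eqF// pnatr_eq0.
rewrite [leRHS]mulrAC ler_wpM2l ?mulr_ge0 ?(ltW m0)//.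
rewrite ler_pdivrMr ?exprn_gt0//.
have -> : 2^-1 ^+ m * 8 ^+ m = 4 ^+ m :> R.
  by rewrite -exprMn; congr (_ ^+ m); lra.
exact: sqr_le_4exp.
Qed.

(** Measured against n! / k^n, the recursion for [u] has the form required by [rec_bound] with F = 1
    + N and S = N; this F covers both u_0 = 1 and the inhomogeneous term. *)
Lemma symbol_bound u g k N : 0 < k -> 0 <= N ->
  (forall m, (0 < m)%N -> `|g m.+1| <= N * (m.+1)`!%:R / (8 * k) ^+ m) ->
  u 0%N = 1 -> g 0%N = 0 -> g 1%N = 1 ->
  gact (@poly_module R) u g =1 g ->
  forall n, `|u n| <= rec_const (1 + N) N * n`!%:R / k ^+ n.
Proof.
move=> k0 N0 gN u0 g0 g1 ug.
(* The term i = 0, equal to (n + 2) g_{n+2}, merges with the leading g_{n+2} and leaves the weight n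
   + 1. *)
have uE n : u n.+1 = - (n.+1%:R * g n.+2) -
    \sum_(i < n) u i.+1 * ((n.+1 - i)%:R * g (n.+1 - i)%N).
  rewrite (symbol_rec n.+1 g0 g1 ug) big_ord_recl /= u0 subn0 mul1r.
  rewrite -[n.+2%:R]natr1 (eq_bigr (fun i : 'I_n =>
    u i.+1 * ((n.+1 - i)%:R * g (n.+1 - i)%N))) => [|i _].
    by rewrite mulrDl mul1r addrAC opprD addrCA subrr addr0 opprD.
  by rewrite /bump /= add1n subSS.
have kn n : 0 < k ^+ n by rewrite exprn_gt0.
have fn n : 0 < n`!%:R :> R by rewrite ltr0n fact_gt0.
move=> n; rewrite ler_pdivlMr// -ler_pdivrMr//.
apply: (@rec_bound _ (1 + N) N (fun n => `|u n| * k ^+ n / n`!%:R)) => //.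
- by rewrite addr_ge0.
- by rewrite u0 normr1 expr0 fact0 divr1 mulr1 lerDl.
move=> {}n M n0 M0 uM; case: n n0 uM => [//|n] _ uM.
have e_n : n.+1%:R * (n.+1%:R * `|g n.+2| * k ^+ n.+1 / (n.+1)`!%:R) <= n.+1%:R * (1 + N).
  rewrite ler_wpM2l//; apply: (le_trans (y := e g k n.+1)).
    rewrite /e ler_wpM2r ?invr_ge0 ?(ltW (fn _))// ler_wpM2r ?(ltW (kn _))//.
    by rewrite ler_wpM2r// ler_nat.
  apply: le_trans (e_le k0 N0 (gN _ _)) _ => //.
  apply: (le_trans (y := N)); last by rewrite lerDr.
  by rewrite ler_piMr// exprn_ile1//; lra.
(* With m + 1 = n - i, the factor n + 1 is absorbed by (n+1)! / ((i+1)! (m+1)!), thanks to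
   [fact_mul_le]. *)
have term (i : 'I_n) : n.+1%:R * (`|u i.+1| * ((n.+1 - i)%:R * `|g (n.+1 - i)%N|) *
    k ^+ n.+1 / (n.+1)`!%:R) <= M * (N * 2^-1 ^+ (n - i)).
  have [m mE] : exists m, (n - i = m.+1)%N.
    by exists (n - i).-1; have := ltn_ord i; lia.
  have n1E : (n.+1 = i.+1 + m.+1)%N by have := ltn_ord i; lia.
  have -> : (n.+1 - i = m.+2)%N by lia.
  rewrite mE.
  have eN : e g k m.+1 <= N * 2^-1 ^+ m.+1 by apply: e_le; rewrite ?gN.
  have uMi : `|u i.+1| * k ^+ i.+1 / (i.+1)`!%:R <= M by apply: uM; have := ltn_ord i; lia.
  have fac : n.+1%:R * ((i.+1)`!%:R * (m.+1)`!%:R) <= (n.+1)`!%:R :> R.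
    have -> : (m.+1 = n.+1 - i.+1)%N by lia.
    by apply: fact_mul_le; have := ltn_ord i; lia.
  apply: (le_trans (y := (`|u i.+1| * k ^+ i.+1 / (i.+1)`!%:R) * e g k m.+1)); last first.
    rewrite ler_pM// ?mulr_ge0 ?invr_ge0 ?(ltW (fn _)) ?(ltW (kn _))//.
  pose c := `|u i.+1| * (m.+2%:R * `|g m.+2|) * k ^+ n.+1.
  have c0 : 0 <= c by rewrite !mulr_ge0// ltW.
  have -> : `|u i.+1| * k ^+ i.+1 / (i.+1)`!%:R * e g k m.+1 =
      c / ((i.+1)`!%:R * (m.+1)`!%:R).
    rewrite /e /c n1E exprD invfM; set x := (i.+1)`!%:R^-1; set y := (m.+1)`!%:R^-1.
    by rewrite /=; ring.
  rewrite -/c mulrCA ler_wpM2l// ler_pdivrMr// mulrC ler_pdivlMr//.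
apply: (le_trans (y := n.+1%:R * (n.+1%:R * `|g n.+2| * k ^+ n.+1 / (n.+1)`!%:R) +
   \sum_(i < n) n.+1%:R * (`|u i.+1| * ((n.+1 - i)%:R * `|g (n.+1 - i)%N|) *
    k ^+ n.+1 / (n.+1)`!%:R))).
  rewrite -mulr_sumr -mulrDr ler_wpM2l//.
  rewrite -!mulr_suml -!mulrDl ler_wpM2r ?invr_ge0 ?(ltW (fn _))// ler_wpM2r ?(ltW (kn _))//.
  rewrite uE; apply: le_trans (ler_normB _ _) _; rewrite normrN normrM normr_nat lerD2l.
  apply: le_trans (ler_norm_sum _ _ _) _; apply: ler_sum => i _.
  by rewrite !normrM normr_nat.
apply: lerD => //; apply: le_trans (ler_sum _ (fun i _ => term i)) _.
rewrite -!mulr_sumr mulrCA ler_wpM2l// -[leRHS]mulr1 ler_wpM2l//.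
rewrite (reindex_inj rev_ord_inj) /=.
rewrite (eq_bigr (fun i : 'I_n => 2^-1 ^+ i.+1)) ?sum_half// => i _.
by rewrite subKn.
Qed.

End SymbolEstimate.

Section OperatorEstimates.
Context {R : realType} {H : completeNormedModType R}.
Implicit Types (A B : 'B(H)) (X Y : nat -> 'B(H)).

Lemma bop_normM A B : `|A * B| <= `|A| * `|B|.
Proof.
rewrite !bop_normE; apply: opnorm_le => x x1; rewrite bopME.
apply: le_trans (opnormP _ _) _; rewrite ler_wpM2l ?opnorm_ge0//.
exact: opnorm_ge.
Qed.

Lemma bop_norm1 : `|1 : 'B(H)| <= 1.
Proof. by rewrite bop_normE; apply: opnorm_le => x; rewrite bop1E. Qed.

Variable rho : {linear vect R -> 'B(H)}.
Hypothesis rho_rep : is_representation rho.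

(* [L_1, L_n] = (n - 1) L_{n+1} gives the factorial decay. *)
Lemma rep_bound : exists K s : R, [/\ 0 <= K, 1 <= s &
  forall i, `|rho (vectL i)| <= K * s ^+ i.+1 / (i.+1)`!%:R].
Proof.
set a := `|rho (vectL 0)|.
(* The first constant handles L_1 and L_2. The induction needs 2 a (j + 3) / (j + 1) <= s, and (j +
   3) / (j + 1) <= 3 explains 6 a. *)
exists (a + 2 * `|rho (vectL 1)|), (6 * a + 1).
have a0 : 0 <= a by apply: normr_ge0.
have a1 : 0 <= `|rho (vectL 1)| by apply: normr_ge0.
set K := a + _; set s := 6 * a + 1.
have s1 : 1 <= s by rewrite /s; lra.
have K0 : 0 <= K by rewrite /K; lra.
have s0 : 0 <= s by apply: le_trans s1.
split=> //.
have f0 m : 0 < m`!%:R :> R by rewrite ltr0n fact_gt0.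
elim=> [|[|j] IHj].
- rewrite factS fact0 muln1 divr1 expr1 -/a.
  apply: (le_trans (y := K)); first by rewrite /K; lra.
  by rewrite ler_peMr.
- rewrite ler_pdivlMr// !factS fact0 !muln1.
  apply: (le_trans (y := K)); first by rewrite /K; lra.
  by rewrite ler_peMr// exprn_ege1.
have j0 : 0 < j.+1%:R :> R by rewrite ltr0n.
rewrite -(ler_pM2l j0).
have -> : j.+1%:R * `|rho (vectL j.+2)| =
    `|rho (vectL 0) * rho (vectL j.+1) - rho (vectL j.+1) * rho (vectL 0)|.
  by rewrite -rho_rep vect_bracketL linearZ normrZ subr0 normr_nat.
apply: (le_trans (y := 2 * a * `|rho (vectL j.+1)|)).
  apply: le_trans (ler_normB _ _) _.
  apply: le_trans (lerD (bop_normM _ _) (bop_normM _ _)) _.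
  by rewrite -/a; lra.
apply: (le_trans (y := 2 * a * (K * s ^+ j.+2 / (j.+2)`!%:R))).
  by rewrite ler_wpM2l// mulr_ge0.
rewrite exprS [(j.+3)`!]factS natrM.
have -> : j.+1%:R * (K * (s * s ^+ j.+2) / (j.+3%:R * (j.+2)`!%:R)) =
    (j.+1%:R / j.+3%:R * s) * (K * s ^+ j.+2 / (j.+2)`!%:R).
  by rewrite invfM -!mulrA; congr (_ * _); rewrite !mulrA; congr (_ / _); ring.
rewrite ler_wpM2r ?mulr_ge0 ?invr_ge0 ?exprn_ge0 ?(ltW (f0 _))//.
rewrite mulrAC ler_pdivlMr ?ltr0n//.
have -> : j.+3%:R = j.+1%:R + 2 :> R by rewrite -natrD addn2.
have j1 : 1 <= j.+1%:R :> R by rewrite ler1n.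
have : 0 <= a * (j.+1%:R - 1) by rewrite mulr_ge0// subr_ge0.
by rewrite /s; lra.
Qed.

(** Measured against 8^-n, the kernel 16^-i becomes 2^-i, whose sum is at most 1, so [rec_bound]
    applies with F = 1 and S = Q. *)
Lemma majorant_bound X (Q : R) : X 0%N = 1 -> 0 <= Q ->
  (forall n, n%:R * `|X n| <= \sum_(i < n) Q * 16^-1 ^+ i.+1 * `|X (n - i.+1)%N|) ->
  forall n, `|X n| <= rec_const 1 Q * 8^-1 ^+ n.
Proof.
move=> X0 Q0 Xrec n.
have p8 m : 0 < 8 ^+ m :> R by rewrite exprn_gt0.
rewrite exprVn ler_pdivlMr//.
apply: (@rec_bound _ 1 Q (fun n => `|X n| * 8 ^+ n)) => //.
  by rewrite X0 expr0 mulr1 bop_norm1.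
move=> {}n M n0 M0 XM; rewrite mulrA.
apply: (le_trans (y := (\sum_(i < n) Q * 16^-1 ^+ i.+1 * `|X (n - i.+1)%N|) * 8 ^+ n)).
  by rewrite ler_wpM2r// ltW.
apply: (le_trans (y := Q * M)); last by rewrite lerDr mulr_ge0.
apply: (le_trans (y := \sum_(i < n) Q * M * 2^-1 ^+ i.+1)); last first.
  by rewrite -mulr_sumr ler_piMr ?mulr_ge0// sum_half.
rewrite mulr_suml; apply: ler_sum => i _.
have -> : 8 ^+ n = 8 ^+ i.+1 * 8 ^+ (n - i.+1) :> R by rewrite -exprD subnKC.
have -> : Q * 16^-1 ^+ i.+1 * `|X (n - i.+1)%N| * (8 ^+ i.+1 * 8 ^+ (n - i.+1)) =
    Q * (16^-1 ^+ i.+1 * 8 ^+ i.+1) * (`|X (n - i.+1)%N| * 8 ^+ (n - i.+1)).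
  by ring.
rewrite -exprMn (_ : 16^-1 * 8 = 2^-1 :> R); last by field.
rewrite -!mulrA ler_wpM2l// [leRHS]mulrC ler_wpM2l ?exprn_ge0//.
by apply: XM; have := ltn_ord i; lia.
Qed.

(** The radius [t] depends on [rho] alone and [C] on [rho] and [N], not on [g]; this uniformity is
    what continuity requires. *)
Lemma integrated_term_bound : exists2 t : R, 0 < t &
  forall N : R, 0 <= N -> exists2 C : R, 0 <= C & forall g : formal_diff R,
  (forall m, (0 < m)%N -> `|g m.+1| <= N * (m.+1)`!%:R / t ^+ m) ->
  (forall n, `|integrated_term rho g n| <= C * 8^-1 ^+ n) /\
  (forall V : nat -> 'B(H), V 0%N = 1 ->
    (forall n, n%:R *: V n = cmul V (op_symbol rho (symbol (fdiff_log g))) n) ->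
    forall n, `|V n| <= C * 8^-1 ^+ n).
Proof.
have [K [s [K0 s1 Ks]]] := rep_bound.
have s0 : 0 < s by apply: lt_le_trans s1.
(* The factorials cancel in |u_i| |rho(L_i)| <= D K (s / k)^i = D K 16^-i, and 8 k is the radius
   asked for by [symbol_bound]. *)
pose k := 16 * s; have k0 : 0 < k by rewrite mulr_gt0.
exists (8 * k) => [|N N0]; first by rewrite mulr_gt0.
pose D := rec_const (1 + N) N; have D0 : 0 <= D by rewrite rec_const_ge0// addr_ge0.
have Q0 : 0 <= D * K by rewrite mulr_ge0.
exists (rec_const 1 (D * K)) => [|g gN]; first by rewrite rec_const_ge0.
have [g0 g1] := fdiff_coefP g.
set u := symbol (fdiff_log g).
have uD n : `|u n| <= D * n`!%:R / k ^+ n.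
  apply: (symbol_bound k0 N0 gN (symbol0 _) g0 g1).
  exact: gact_symbol_fdiff.
have uA i : `|op_symbol rho u i.+1| <= D * K * 16^-1 ^+ i.+1.
  rewrite /= normrZ.
  apply: (le_trans (ler_pM _ _ (uD _) (Ks _))) => //.
  rewrite le_eqVlt; apply/orP; left; apply/eqP.
  have fi : (i.+1)`!%:R != 0 :> R by rewrite pnatr_eq0 -lt0n fact_gt0.
  have si : s ^+ i.+1 != 0 by rewrite expf_neq0// gt_eqF.
  rewrite /k exprMn exprVn; field.
  by rewrite fi si expf_neq0// pnatr_eq0.
have rec_le X (Y : nat -> nat -> 'B(H)) n :
    n%:R *: X n = \sum_(i < n) Y i n ->
    (forall i, (i < n)%N -> `|Y i n| <= `|op_symbol rho u i.+1| * `|X (n - i.+1)%N|) ->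
    n%:R * `|X n| <= \sum_(i < n) D * K * 16^-1 ^+ i.+1 * `|X (n - i.+1)%N|.
  move=> XY YX; rewrite -[n%:R]ger0_norm// -normrZ XY.
  apply: le_trans (ler_norm_sum _ _ _) _; apply: ler_sum => i _.
  by apply: le_trans (YX _ (ltn_ord i)) _; rewrite ler_wpM2r// uA.
split=> [|V V0 VE]; [apply: majorant_bound => // [|n]|apply: majorant_bound => // n].
- exact: integrated_term0.
- apply: (rec_le _ (fun i n => - (op_symbol rho u i.+1 * integrated_term rho g (n - i.+1)%N))).
    rewrite integrated_term_rec// /cmul big_ord_recl mul0r add0r.
    by rewrite -sumrN; apply: eq_bigr.
  by move=> i _; rewrite normrN bop_normM.
- apply: (rec_le _ (fun i n => V (n - i.+1)%N * op_symbol rho u i.+1)).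
    rewrite VE /cmul big_ord_recr /= subnn mulr0 addr0.
    rewrite (reindex_inj rev_ord_inj); apply: eq_bigr => i _ /=.
    by rewrite subnA// subnn add0n.
  by move=> i _; rewrite mulrC bop_normM.
Qed.

End OperatorEstimates.

(** * Convergence *)

Section GeometricSeries.
Context {R : realType}.

Lemma sum_geo8 m n : (m <= n)%N ->
  \sum_(m <= i < n) (8^-1 : R) ^+ i <= 2 * 8^-1 ^+ m.
Proof.
(* The sharper bound, with the term in n subtracted, is the one that passes through the
   induction. *)
move=> mn; apply: (le_trans (y := 2 * (8^-1 ^+ m - 8^-1 ^+ n))); last first.
  by rewrite ler_wpM2l// gerBl exprn_ge0.
elim: n mn => [|n IHn] mn.
  by rewrite big_geq// mulr_ge0// subr_ge0 ler_wiXn2l//; lra.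
move: mn; rewrite leq_eqVlt => /predU1P[->|mn].
  by rewrite big_geq// subrr mulr0.
rewrite big_nat_recr//=; have := IHn mn; have : 0 <= (8^-1 : R) ^+ n by rewrite exprn_ge0.
by rewrite exprS; lra.
Qed.

Context {V : normedModType R}.
Implicit Types (u : nat -> V) (C : R).

Lemma series_geo_dist u C N M : 0 <= C -> (forall n, `|u n| <= C * 8^-1 ^+ n) ->
  (N <= M)%N -> `|series u M - series u N| <= 2 * C * 8^-1 ^+ N.
Proof.
move=> C0 uC NM; rewrite sub_series NM.
apply: le_trans (ler_norm_sum _ _ _) _.
apply: le_trans (ler_sum _ (fun i _ => uC i)) _.
by rewrite -mulr_sumr (mulrC 2) -mulrA ler_wpM2l// sum_geo8.
Qed.

Lemma cvg_geo (u : nat -> V) (l : V) C q : 0 <= q < 1 ->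
  (forall n, `|l - u n| <= C * q ^+ n) -> u @ \oo --> l.
Proof.
move=> /andP[q0 q1] uC; apply/cvgrPdist_le => e e0.
have q1' : `|q| < 1 by rewrite ger0_norm.
have /cvgrPdist_le/(_ e e0) := cvg_geometric C q1'.
apply: filterS => n; rewrite sub0r normrN => h.
exact: le_trans (uC n) (le_trans (ler_norm _) h).
Qed.

End GeometricSeries.

Section OperatorSums.
Context {R : realType} {H : completeNormedModType R}.
Implicit Types (X Y : nat -> 'B(H)) (C D : R).

(** The limit is built pointwise from the completeness of H; the tail estimate, uniform on the unit
    ball, turns pointwise convergence into convergence in norm. *)
Let bop_series_cvg X C : 0 <= C -> (forall n, `|X n| <= C * 8^-1 ^+ n) ->
  exists L : 'B(H), forall N, `|L - series X N| <= 2 * C * 8^-1 ^+ N.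
Proof.
move=> C0 XC.
have seriesE N x : series X N x = series (fun n => X n x) N.
  by rewrite /series /=; elim/big_rec2: _ => // i y z _ <-.
have XxC x n : `|X n x| <= C * `|x| * 8^-1 ^+ n.
  rewrite mulrAC; apply: le_trans (opnormP _ _) _.
  by rewrite ler_wpM2r// -bop_normE.
have cvgx x : cvgn (series (fun n => X n x)).
  apply: normed_cvg; apply: (series_le_cvg (v_ := geometric (C * `|x|) 8^-1)) => //.
  - by move=> n; apply: normr_ge0.
  - by move=> n; rewrite /geometric /= !mulr_ge0// exprn_ge0.
  - by move=> n; apply: XxC.
  - by apply: is_cvg_geometric_series; rewrite ger0_norm//; lra.
pose L x := limn (series (fun n => X n x)).
have Ldist x N : `|L x - series X N x| <= 2 * C * 8^-1 ^+ N * `|x|.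
  apply/ler_addgt0Pr => e e0.
  have /cvgrPdist_le/(_ e e0) [M _ MP] := cvgx x.
  pose m := maxn M N.
  have -> : L x - series X N x = (series X m x - series X N x) + (L x - series X m x).
    by rewrite [RHS]addrC addrA subrK.
  apply: le_trans (ler_normD _ _) _; apply: lerD; last first.
    by rewrite seriesE; apply: MP; rewrite /= leq_maxl.
  rewrite (seriesE m) (seriesE N).
  apply: le_trans (series_geo_dist (C := C * `|x|) _ (XxC x) _) _.
  - by rewrite mulr_ge0.
  - by rewrite leq_maxr.
  - by rewrite le_eqVlt; apply/orP; left; apply/eqP; ring.
have Llin : linear L.
  move=> a x y; apply: cvg_lim => //.
  rewrite (_ : series _ = fun N => a *: series (fun n => X n x) N + series (fun n => X n y) N).
    by apply: cvgD; [apply: cvgZr; apply: cvgx|apply: cvgx].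
  by apply/funext => N; rewrite -!seriesE linearP.
have Lbnd : L \in bounded_linear.
  apply/asboolP; split=> //; exists (2 * C) => x.
  have := Ldist x 0%N; rewrite expr0 mulr1.
  by rewrite /series /= big_geq// subr0.
exists (BoundedOp Lbnd) => N; rewrite bop_normE; apply: opnorm_le => x x1.
apply: le_trans (Ldist x N) _.
by rewrite ler_piMr// !mulr_ge0// exprn_ge0.
Qed.

Lemma bop_series_cvgn X C : 0 <= C -> (forall n, `|X n| <= C * 8^-1 ^+ n) ->
  cvgn (series X).
Proof.
move=> C0 /(bop_series_cvg C0)[L LX]; apply/cvg_ex; exists L.
by apply: (cvg_geo (q := 8^-1)) LX; apply/andP; split; lra.
Qed.

Lemma bop_series_lim_dist X C N : 0 <= C -> (forall n, `|X n| <= C * 8^-1 ^+ n) ->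
  `|limn (series X) - series X N| <= 2 * C * 8^-1 ^+ N.
Proof.
move=> C0 /(bop_series_cvg C0)[L LX].
have -> // : limn (series X) = L.
by apply: cvg_lim => //; apply: (cvg_geo (q := 8^-1)) LX; apply/andP; split; lra.
Qed.

(** The error collects the products X_i Y_j with i, j < N and i + j >= N: at most N^2 of them, each
    at most C D 8^-N, and N^2 <= 4^N. *)
Lemma series_cmul_dist X Y C D N : (forall n, `|X n| <= C * 8^-1 ^+ n) ->
  (forall n, `|Y n| <= D * 8^-1 ^+ n) -> 0 <= C -> 0 <= D ->
  `|series X N * series Y N - series (cmul X Y) N| <= C * D * 2^-1 ^+ N.
Proof.
move=> XC YD C0 D0; rewrite /series /= !big_mkord.
case: N => [|N]; first by rewrite !big_ord0 mul0r subrr normr0 !mulr_ge0.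
rewrite /cmul (sum_triangle (fun i j => X i * Y j)) mulr_suml -sumrB.
apply: le_trans (ler_norm_sum _ _ _) _.
apply: (le_trans (y := \sum_(i < N.+1) \sum_(j < N.+1) C * D * 8^-1 ^+ N.+1)); last first.
  rewrite !sumr_const !card_ord -mulrnA -[_ *+ (_ * _)]mulr_natr natrM -!mulrA.
  rewrite ler_wpM2l// ler_wpM2l//.
  have -> : N.+1%:R * N.+1%:R = N.+1%:R ^+ 2 :> R by rewrite expr2.
  apply: (le_trans (y := 8^-1 ^+ N.+1 * 4 ^+ N.+1)).
    rewrite ler_wpM2l ?exprn_ge0//; apply: le_trans (sqr_le_4exp _) _.
    by rewrite ler_weXn2l// ler1n.
  by rewrite -exprMn (_ : 8^-1 * 4 = 2^-1 :> R); last by field.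
apply: ler_sum => i _.
have iN : ((N - i).+1 <= N.+1)%N by rewrite ltnS leq_subr.
rewrite (big_ord_widen _ (fun j => X i * Y j) iN).
rewrite mulr_sumr [X in X - _](bigID (fun j : 'I_N.+1 => (j < (N - i).+1)%N)) /=.
rewrite addrAC subrr add0r; apply: le_trans (ler_norm_sum _ _ _) _.
rewrite [leRHS](bigID (fun j : 'I_N.+1 => ~~ (j < (N - i).+1)%N)) /=.
apply: ler_wpDr; first by apply: sumr_ge0 => j _; rewrite !mulr_ge0// exprn_ge0.
apply: ler_sum => j; rewrite -leqNgt => ij.
apply: le_trans (bop_normM _ _) _; apply: le_trans (ler_pM _ _ (XC _) (YD _)) _ => //.
rewrite mulrACA -exprD ler_wpM2l ?mulr_ge0// ler_wiXn2l//; first by lra.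
by have := ltn_ord i; lia.
Qed.

Lemma cvg_series_cmul X Y C D : 0 <= C -> 0 <= D ->
  (forall n, `|X n| <= C * 8^-1 ^+ n) -> (forall n, `|Y n| <= D * 8^-1 ^+ n) ->
  series (cmul X Y) @ \oo --> limn (series X) * limn (series Y).
Proof.
move=> C0 D0 XC YD.
have XL M := bop_series_lim_dist M C0 XC.
have YL M := bop_series_lim_dist M D0 YD.
(* Here 9 = 4 + 4 + 1: each of the two tails contributes 2 C times 2 D, and [series_cmul_dist]
   contributes C D. *)
apply: (cvg_geo (q := 2^-1) (C := 9 * (C * D))) => [|N]; first by apply/andP; split; lra.
set A := limn (series X) in XL *; set B := limn (series Y) in YL *.
have -> : A * B - series (cmul X Y) N = (A - series X N) * B +
    series X N * (B - series Y N) + (series X N * series Y N - series (cmul X Y) N).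
  by rewrite mulrBl mulrBr !addrA !subrK.
have B2 : `|B| <= 2 * D.
  by have := YL 0%N; rewrite /series /= big_geq// subr0 mulr1.
have X2 : `|series X N| <= 2 * C.
  have := series_geo_dist C0 XC (leq0n N).
  by rewrite {2}/series /= big_geq// subr0 mulr1.
have e82 : (8^-1 : R) ^+ N <= 2^-1 ^+ N by rewrite lerXn2r// ?nnegrE; lra.
have e8 : 0 <= (8^-1 : R) ^+ N by rewrite exprn_ge0.
apply: (le_trans (y := 2 * C * 2^-1 ^+ N * (2 * D) + 2 * C * (2 * D * 2^-1 ^+ N) +
    C * D * 2^-1 ^+ N)); last by rewrite le_eqVlt; apply/orP; left; apply/eqP; ring.
apply: le_trans (ler_normD _ _) _; apply: lerD; last exact: series_cmul_dist.
apply: le_trans (ler_normD _ _) _; apply: lerD.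
  apply: le_trans (bop_normM _ _) _; apply: ler_pM => //.
  by apply: le_trans (XL N) _; rewrite ler_wpM2l// mulr_ge0.
apply: le_trans (bop_normM _ _) _; apply: ler_pM => //.
by apply: le_trans (YL N) _; rewrite ler_wpM2l// mulr_ge0.
Qed.

End OperatorSums.

(** * The topology of Diff^o and continuity of the integrated representation *)

Section DiffoTopology.
Context {R : realType}.
Implicit Types (g : diffo R) (a : nat -> R) (sigma r : R).

Lemma coef_norm_ge sigma a m : 0 < sigma -> (0 < m)%N ->
  ((`|a m.+1| * sigma ^+ m / (m.+1)`!%:R)%:E <= coef_norm sigma a)%E.
Proof.
move=> s0 m0.
have t0 j : (0 <= (`|a j| * sigma ^+ j.-1 / j`!%:R)%:E)%E.
  by rewrite lee_fin !mulr_ge0// exprn_ge0// ltW.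
apply: le_trans (nneseries_lim_ge m.+2 _) => //.
rewrite big_nat_recr//= leeDr//.
by apply: sume_ge0 => j _.
Qed.

Lemma coef_norm_bound sigma a (N : R) m : 0 < sigma -> (0 < m)%N ->
  (coef_norm sigma a <= N%:E)%E -> `|a m.+1| <= N * (m.+1)`!%:R / sigma ^+ m.
Proof.
move=> s0 m0 aN; have := le_trans (coef_norm_ge a s0 m0) aN.
rewrite lee_fin ler_pdivrMr ?ltr0n ?fact_gt0// => h.
by rewrite ler_pdivlMr// exprn_gt0.
Qed.

Lemma nbhs_diffo_ball g sigma r : 0 < sigma -> 0 < r ->
  nbhs g (diffo_ball (g, sigma, r)).
Proof.
move=> s0 r0.
apply: open_nbhs_nbhs; split.
  exists [set diffo_ball (g, sigma, r)]; last by rewrite bigcup_set1.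
  move=> _ ->; apply: finI_from1; by split.
rewrite /diffo_ball /= /coef_norm eseries0 ?lte_fin// => j _ _.
by rewrite subrr normr0 !mul0r.
Qed.

Lemma diffo_coef_cvg g j : (h : diffo R) j @[h --> g] --> g j.
Proof.
apply/(cvgrPdist_le (FF := nbhs_filter g)) => e e0.
have f0 : 0 < j`!%:R :> R by rewrite ltr0n fact_gt0.
(* At sigma = 1 the coefficient of index j has weight 1 / j!, which this radius compensates; the
   coefficients of index 0 and 1 are constant. *)
have r0 : 0 < e / j`!%:R by rewrite divr_gt0.
apply: filterS (nbhs_diffo_ball g ltr01 r0) => h /ltW/= hr.
have [[g0 g1] [h0 h1]] := (fdiff_coefP g, fdiff_coefP h).
case: j f0 r0 hr => [|[|j]] f0 r0 hr; rewrite ?g0 ?g1 ?h0 ?h1 ?subrr ?normr0 ?(ltW e0)//.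
have := coef_norm_bound ltr01 (ltn0Sn j) hr.
by rewrite expr1n divr1 divfK ?gt_eqF// distrC.
Qed.

End DiffoTopology.

Section Continuity.
Context {R : realType} {H : completeNormedModType R}.
Variable rho : {linear vect R -> 'B(H)}.
Hypothesis rho_rep : is_representation rho.
Implicit Types g : diffo R.

Lemma bop_mul_cvg (T : Type) (F : set_system T) (FF : Filter F)
    (A : 'B(H)) (f : T -> 'B(H)) (l : 'B(H)) :
  f x @[x --> F] --> l -> A * f x @[x --> F] --> A * l.
Proof.
move=> fl; apply/cvgrPdist_le => e e0.
have A0 : 0 < `|A| + 1 by rewrite ltr_wpDl.
have /cvgrPdist_le/(_ (e / (`|A| + 1))) := fl.
move=> /(_ (divr_gt0 e0 A0)); apply: filterS => x h.
rewrite -mulrBr; apply: le_trans (bop_normM _ _) _.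
move: h; rewrite ler_pdivlMr// => h; apply: le_trans h.
by rewrite mulrC ler_wpM2l// lerDl.
Qed.

Section CoefficientLimits.
Context {T : Type} {F : set_system T} {FF : Filter F}.
Variables (h : T -> formal_diff R) (g : formal_diff R).
Hypothesis hg : forall j, h x j @[x --> F] --> g j.

(** As [fdiff_log] is obtained by choice, continuity is read off [symbol_rec], which is polynomial
    in the coefficients of the diffeomorphism and the earlier symbol coefficients. *)
Lemma symbol_cvg n :
  symbol (fdiff_log (h x)) n @[x --> F] --> symbol (fdiff_log g) n.
Proof.
elim/ltn_ind: n => n IHn.
have uE (k : formal_diff R) := symbol_rec n (proj1 (fdiff_coefP k))
  (proj2 (fdiff_coefP k)) (gact_symbol_fdiff k).
rewrite uE; under eq_cvg do rewrite uE.
apply: cvgB; first exact: hg.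
apply: cvg_big => [|i _]; first exact: add_continuous.
apply: cvgM; first exact: IHn.
by apply: cvgM; [exact: cvg_cst|exact: hg].
Qed.

Lemma integrated_term_cvg n :
  integrated_term rho (h x) n @[x --> F] --> integrated_term rho g n.
Proof.
elim/ltn_ind: n => -[_|n IHn].
  rewrite integrated_term0//; under eq_cvg do rewrite (integrated_term0 rho_rep).
  exact: cvg_cst.
have n1 : n.+1%:R != 0 :> R by rewrite pnatr_eq0.
have WE (k : formal_diff R) : integrated_term rho k n.+1 = n.+1%:R^-1 *:
    \sum_(i < n.+1) (- symbol (fdiff_log k) i.+1) *:
      (rho (vectL i) * integrated_term rho k (n - i)%N).
  apply: (scalerI n1); rewrite integrated_term_rec// scalerA divff// scale1r.
  rewrite /cmul big_ord_recl mul0r add0r -sumrN; apply: eq_bigr => i _ /=.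
  by rewrite scaleNr bop_scalerAl.
rewrite WE; under eq_cvg do rewrite WE.
apply: cvgZr; apply: cvg_big => [|i _]; first exact: add_continuous.
apply: cvgZ; first by apply: cvgN; exact: symbol_cvg.
by apply: bop_mul_cvg; apply: IHn; rewrite ltnS leq_subr.
Qed.

Lemma series_integrated_term_cvg n :
  series (integrated_term rho (h x)) n @[x --> F] -->
  series (integrated_term rho g) n.
Proof.
apply: cvg_big => [|i _]; first exact: add_continuous.
exact: integrated_term_cvg.
Qed.

End CoefficientLimits.

(** The partial sums are continuous and, by the locally uniform geometric bound, converge uniformly
    near each point. *)
Lemma integrated_continuous : continuous (fun g : diffo R => integrated rho g).
Proof.
move=> g; have [t t0 bnd] := integrated_term_bound rho_rep.
(* On the ball of radius 1 about [g] for the norm of parameter [t], this [N] bounds all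
   coefficients, so one [C] serves the whole neighbourhood. *)
pose N := fine (coef_norm t g) + 1.
have gfin : coef_norm t g \is a fin_num.
  rewrite ge0_fin_numE ?diffo_norm_fin//.
  by apply: nneseries_ge0 => j _ _; rewrite lee_fin !mulr_ge0// exprn_ge0// ltW.
have N0 : 0 <= N.
  rewrite addr_ge0// fine_ge0//.
  by apply: nneseries_ge0 => j _ _; rewrite lee_fin !mulr_ge0// exprn_ge0// ltW.
have [C C0 CP] := bnd N N0.
have nearC : \forall h \near g, forall n,
    `|integrated_term rho (h : diffo R) n| <= C * 8^-1 ^+ n.
  apply: filterS (nbhs_diffo_ball g t0 ltr01) => h /ltW/= hg.
  have [|//] := CP h; move=> m m0.
  have := coef_norm_bound t0 m0 hg.
  have gN : (coef_norm t g <= (fine (coef_norm t g))%:E)%E by rewrite fineK.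
  have := coef_norm_bound t0 m0 gN.
  move=> h1 h2.
  have -> : h m.+1 = g m.+1 + (h m.+1 - g m.+1) by rewrite addrC subrK.
  apply: le_trans (ler_normD _ _) _; apply: le_trans (lerD h1 h2) _.
  by rewrite -!mulrDl.
apply/(cvgrPdist_le (FF := nbhs_filter g)) => e e0.
have q1 : `|8^-1 : R| < 1 by rewrite ger0_norm//; lra.
have eE : e / 4 + e / 2 + e / 4 = e by field.
have e4 : 0 < e / 4 by rewrite divr_gt0.
have /cvgrPdist_le/(_ _ e4)[M _ MP] := cvg_geometric (2 * C) q1.
have tail : 2 * C * 8^-1 ^+ M <= e / 4.
  by have := MP M (leqnn M); rewrite /= sub0r normrN; exact: (le_trans (ler_norm _)).
have e2 : 0 < e / 2 by rewrite divr_gt0.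
have /(cvgrPdist_le (FF := nbhs_filter g))/(_ _ e2) nearS :=
  @series_integrated_term_cvg _ _ (nbhs_filter g) (fun h => h) g
    (@diffo_coef_cvg R g) M.
have gC := nbhs_singleton nearC.
apply: filterS2 nearC nearS => h hC hS.
have hd := bop_series_lim_dist M C0 hC.
have gd := bop_series_lim_dist M C0 gC.
rewrite distrC in hd; rewrite /integrated.
have -> : limn (series (integrated_term rho g)) - limn (series (integrated_term rho h)) =
  (limn (series (integrated_term rho g)) - series (integrated_term rho g) M) +
  (series (integrated_term rho g) M - series (integrated_term rho h) M) +
  (series (integrated_term rho h) M - limn (series (integrated_term rho h))).
  by rewrite !addrA !subrK.
apply: le_trans (ler_normD _ _) _; rewrite -[leRHS]eE.
apply: lerD; last exact: le_trans hd tail.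
by apply: le_trans (ler_normD _ _) _; apply: lerD => //; apply: le_trans gd tail.
Qed.

Lemma diffo_term_bound g : exists2 C : R, 0 <= C &
  (forall n, `|integrated_term rho g n| <= C * 8^-1 ^+ n) /\
  (forall V : nat -> 'B(H), V 0%N = 1 ->
    (forall n, n%:R *: V n = cmul V (op_symbol rho (symbol (fdiff_log g))) n) ->
    forall n, `|V n| <= C * 8^-1 ^+ n).
Proof.
have [t t0 bnd] := integrated_term_bound rho_rep.
have n0 : (0 <= coef_norm t g)%E.
  by apply: nneseries_ge0 => j _ _; rewrite lee_fin !mulr_ge0// exprn_ge0// ltW.
have [C C0 CP] := bnd (fine (coef_norm t g)) (fine_ge0 n0).
exists C => //; apply: CP => m m0; apply: coef_norm_bound => //.
by rewrite fineK// ge0_fin_numE// diffo_norm_fin.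
Qed.

End Continuity.

Unset Implicit Arguments.
Set Strict Implicit.

Theorem proposition1p4 (R : realType) (H : completeNormedModType R)
    (rho : {linear vect R -> 'B(H)}) (rho_rep : is_representation rho) :
  [/\ forall g : diffo R, cvgn (series (integrated_term rho g)),
      forall g : diffo R, invertible_op (integrated rho g),
      forall g1 g2 : diffo R,
        integrated rho (fdiff_mul g1 g2) = integrated rho g1 * integrated rho g2
    & continuous (fun g : diffo R => integrated rho g)].
Proof.
split=> [g|g|g1 g2|]; last exact: integrated_continuous.
- by have [C C0 [WC _]] := diffo_term_bound rho_rep g; apply: bop_series_cvgn WC.
- have [C C0 [WC VC]] := diffo_term_bound rho_rep g.
  have [V [V0 VE VW WV]] := inverse_term_exists rho_rep g.
  have {}VC := VC V V0 VE.
  (* The empty partial sum is 0 and all later ones are 1. *)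
  have c1 : series (@cone 'B(H)) @ \oo --> (1 : 'B(H)).
    apply: cvg_near_cst; exists 1%N => // -[//|n] _ /=.
    by rewrite /series /= big_nat_recl// big1 ?addr0.
  exists (limn (series V)); split.
    have := cvg_series_cmul C0 C0 WC VC; rewrite (funext WV) => /(cvg_lim _) <- //.
    exact: cvg_lim.
  have := cvg_series_cmul C0 C0 VC WC; rewrite (funext VW) => /(cvg_lim _) <- //.
  exact: cvg_lim.
have [C C0 [WC _]] := diffo_term_bound rho_rep g1.
have [D D0 [WD _]] := diffo_term_bound rho_rep g2.
rewrite /integrated (funext (integrated_termM rho_rep g1 g2)).
by apply: cvg_lim => //; apply: cvg_series_cmul WC WD.
Qed.
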